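(* Let $n\ge 1$ and let $\lambda=a_1\Lambda_1+\cdots+a_n\Lambda_n$ ($a_i\in\mathbb{Z}_{\ge 0}$) be a dominant integral weight of type $A_n$. Let $\mathcal{M}(\lambda)$ be the connected component of the crystal $\mathcal{M}$ of Nakajima monomials containing $Y_1(0)^{a_1}\cdots Y_n(0)^{a_n}$, and let $T(\lambda)$ be the crystal of semistandard Young tableaux of shape $\lambda$ with entries in $\{1,\dots,n+1\}$. Then there is a crystal isomorphism $\phi:\mathcal{M}(\lambda)\to T(\lambda)$.
   Context: Type $A_n$: $I=\{1,\dots,n\}$, Cartan matrix $a_{ii}=2$, $a_{ij}=-1$ if $|i-j|=1$, $a_{ij}=0$ otherwise; $\Lambda_1,\dots,\Lambda_n$ are the fundamental weights, and $\Lambda_0=\Lambda_{n+1}=0$. Monomial crystal. $\mathcal{M}$ is the set of Laurent monomials $M=\prod_{i\in I,\,m\in\mathbb{Z}}Y_i(m)^{y_i(m)}$ (with $y_i(m)\in\mathbb{Z}$, almost all $0$) in commuting variables $Y_i(m)$, $i\in I$, $m\in\mathbb{Z}$. By convention $Y_0(m)=Y_{n+1}(m)=1$ for all $m$. Put $\mathrm{wt}(M)=\sum_{i,m}y_i(m)\Lambda_i$, $\varphi_i(M)=\max_{m\in\mathbb{Z}}\sum_{k\le m}y_i(k)$ and $\varepsilon_i(M)=\max_{m\in\mathbb{Z}}\bigl(-\sum_{k>m}y_i(k)\bigr)$ (both are $\ge 0$). Let $n_f$ (resp. $n_e$) be the smallest (resp. largest) integer $m$ with $\varphi_i(M)=\sum_{k\le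 m}y_i(k)$; $n_f$ is needed only if $\varphi_i(M)>0$ and $n_e$ only if $\varepsilon_i(M)>0$. Let $A_i(m)=Y_i(m)Y_i(m+1)Y_{i-1}(m+1)^{-1}Y_{i+1}(m)^{-1}$. The Kashiwara operators are $\tilde f_iM=A_i(n_f)^{-1}M$ if $\varphi_i(M)>0$ and $\tilde f_iM=0$ if $\varphi_i(M)=0$; $\tilde e_iM=A_i(n_e)M$ if $\varepsilon_i(M)>0$ and $\tilde e_iM=0$ if $\varepsilon_i(M)=0$. The crystal graph has an arrow $M\to M'$ of color $i$ whenever $\tilde f_iM=M'$; connected components are those of the underlying undirected graph. Tableau crystal. The Young diagram of shape $\lambda$ (left-justified, top row longest) has $a_i$ columns of length $i$ for $i=1,\dots,n$. A tableau is semistandard if its entries weakly increase from left to right in rows and strictly increase from top to bottom in columns. Let $\mathbf{B}=\{1,\dots,n+1\}$ be the crystal of the vector representation: $\mathrm{wt}(j)=\Lambda_j-\Lambda_{j-1}$, $\tilde f_i(i)=i+1$, $\tilde e_i(i+1)=i$, all other actions being $0$. On tensor products, with $\varepsilon_i(b)=\max\{k:\tilde e_i^kb\ne0\}$ and $\varphi_i(b)=\max\{k:\tilde f_i^kb\neq0\}$: $\tilde e_i(b_1\otimes b_2)=\tilde e_ib_1\otimes b_2$ if $\varphi_i(b_1)\ge\varepsilon_i(b_2)$ and $b_1\otimes\tilde e_ib_2$ otherwise; $\tilde f_i(b_1\otimes b_2)=\tilde f_ib_1\otimes b_2$ if $\varphi_i(b_1)>\varepsilon_i(b_2)$ and $b_1\otimes\tilde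 f_ib_2$ otherwise; weights add. A tableau is identified with the tensor product $b_1\otimes b_2\otimes\cdots\otimes b_N$ of its entries read column by column from the rightmost column to the leftmost, each column from top to bottom; it is known that $T(\lambda)\cup\{0\}$ is stable under $\tilde e_i,\tilde f_i$, and $T(\lambda)$ carries the induced crystal structure (Kashiwara–Nakashima). A crystal isomorphism is a bijection preserving $\mathrm{wt},\varepsilon_i,\varphi_i$ and commuting with $\tilde e_i,\tilde f_i$ (with $0\mapsto0$) for all $i\in I$. *)

(* Defs.v *)
From Stdlib Require Import Relations.
From HB Require Import structures.
From mathcomp Require Import all_boot all_order all_algebra.
From mathcomp Require Import all_classical.
From mathcomp.multinomials Require Import freeg.

Set Implicit Arguments.
Unset Strict Implicit.
Unset Printing Implicit Defensive.

Import Order.TTheory GRing.Theory Num.Theory.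
Local Open Scope classical_set_scope.
Local Open Scope ring_scope.

(* Conventions.  The index set {1, ..., n} is represented by 'I_n and the set
   {1, ..., n+1} by 'I_n.+1, the ordinal i standing for the number i.+1.  The
   functions [fund_weight] and [Y] take the actual (1-based) index, as a nat. *)

(* The greatest and the least element of a set of integers; 0 if there is
   none. *)
Definition zmax (A : set int) : int := xget 0 (A `&` ubound A).
Definition zmin (A : set int) : int := xget 0 (A `&` lbound A).

(* The weight lattice Z Lambda_1 + ... + Z Lambda_n is Z^n.  With this formula
   Lambda_0 = Lambda_(n+1) = 0. *)
Definition fund_weight (n k : nat) : 'rV[int]_n :=
  \row_(j < n) ((j.+1 == k)%N)%:Z.

(* The structure maps of a crystal of type A_n.  [None] is the ghost
   element 0. *)
Record crystal (n : nat) := Crystal {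
  carrier :> Type;
  wt : carrier -> 'rV[int]_n;
  eps : 'I_n -> carrier -> int;
  phi : 'I_n -> carrier -> int;
  kash_e : 'I_n -> carrier -> option carrier;
  kash_f : 'I_n -> carrier -> option carrier
}.

Definition arrow (n : nat) (C : crystal n) (x y : C) : Prop :=
  exists i : 'I_n, kash_f i x = Some y.

Definition component (n : nat) (C : crystal n) (x : C) : set C :=
  [set y | clos_refl_sym_trans C (@arrow n C) x y].

(* Isomorphism between two subcrystals, given as subsets S and T, stable under
   the Kashiwara operators, of the crystals C and D. *)
Definition crystal_iso (n : nat) (C D : crystal n) (S : set C) (T : set D)
    (g : C -> D) : Prop :=
  set_bij S T g /\
  forall (i : 'I_n) (x : C), S x ->
    [/\ wt (g x) = wt x,
        eps i (g x) = eps i x,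
        phi i (g x) = phi i x,
        kash_e i (g x) = omap g (kash_e i x) &
        kash_f i (g x) = omap g (kash_f i x)].

(* The group of Laurent monomials in the Y_i(m), written additively: the free
   abelian group on the pairs (i, m). *)
Definition monomial (n : nat) : Type := {freeg ('I_n * int)%type / int}.

Section Monomials.
Variable n : nat.
Implicit Types (i : 'I_n) (m : int) (M : monomial n).

(* The sum has at most one term; it is empty (that is, Y_k(m) is the monomial
   1) if k = 0 or k = n + 1. *)
Definition Y (k : nat) m : monomial n :=
  \sum_(i < n | (i.+1 == k)%N) << (i, m) >>.

Definition A_ i m : monomial n :=
  Y i.+1 m + Y i.+1 (m + 1) - Y i (m + 1) - Y i.+2 m.

Definition expo M i m : int := coeff (i, m) M.

Definition sum_le M i m : int := \sum_(k \in [set k : int | k <= m]) expo M i k.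
Definition sum_gt M i m : int := \sum_(k \in [set k : int | m < k]) expo M i k.

Definition mon_wt M : 'rV[int]_n :=
  \sum_(i < n) (\sum_(m \in [set: int]) expo M i m) *: fund_weight n i.+1.
Definition mon_phi i M : int := zmax (range (sum_le M i)).
Definition mon_eps i M : int := zmax (range (fun m => - sum_gt M i m)).

Definition n_f i M : int := zmin [set m | mon_phi i M = sum_le M i m].
Definition n_e i M : int := zmax [set m | mon_phi i M = sum_le M i m].

Definition mon_f i M : option (monomial n) :=
  if 0 < mon_phi i M then Some (M - A_ i (n_f i M)) else None.
Definition mon_e i M : option (monomial n) :=
  if 0 < mon_eps i M then Some (M + A_ i (n_e i M)) else None.

Definition monomial_crystal : crystal n :=
  Crystal mon_wt mon_eps mon_phi mon_e mon_f.

(* Here a i is the coefficient a_(i+1) of Lambda_(i+1) in lambda. *)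
Definition mon_hw (a : 'I_n -> nat) : monomial_crystal :=
  (\sum_(i < n) Y i.+1 0 *+ a i : monomial n).

Definition M_lambda (a : 'I_n -> nat) : set monomial_crystal :=
  component (mon_hw a).

End Monomials.

(* max {k | op^k x <> 0} *)
Definition string_length (T : Type) (op : T -> option T) (x : T) : int :=
  zmax [set z | exists2 k : nat, z = k%:Z & iter k (obind op) (Some x) <> None].

Section Tensor.
Variable n : nat.

Definition vect_wt (b : 'I_n.+1) : 'rV[int]_n :=
  fund_weight n b.+1 - fund_weight n b.
Definition vect_f (i : 'I_n) (b : 'I_n.+1) : option 'I_n.+1 :=
  if b == widen_ord (leqnSn n) i then Some (fintype.lift ord0 i) else None.
Definition vect_e (i : 'I_n) (b : 'I_n.+1) : option 'I_n.+1 :=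
  if b == fintype.lift ord0 i then Some (widen_ord (leqnSn n) i) else None.

Definition vector_crystal : crystal n :=
  Crystal vect_wt (fun i => string_length (vect_e i))
    (fun i => string_length (vect_f i)) vect_e vect_f.

Definition trivial_crystal : crystal n :=
  @Crystal n unit (fun=> 0) (fun _ _ => 0) (fun _ _ => 0)
    (fun _ _ => None) (fun _ _ => None).

Section Binary.
Variables C D : crystal n.

Definition tens_wt (b : C * D) : 'rV[int]_n := wt b.1 + wt b.2.
Definition tens_e (i : 'I_n) (b : C * D) : option (C * D) :=
  if eps i b.2 <= phi i b.1
  then omap (fun c => (c, b.2)) (kash_e i b.1)
  else omap (fun d => (b.1, d)) (kash_e i b.2).
Definition tens_f (i : 'I_n) (b : C * D) : option (C * D) :=
  if eps i b.2 < phi i b.1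
  then omap (fun c => (c, b.2)) (kash_f i b.1)
  else omap (fun d => (b.1, d)) (kash_f i b.2).

Definition tensor : crystal n :=
  Crystal tens_wt (fun i => string_length (tens_e i))
    (fun i => string_length (tens_f i)) tens_e tens_f.

End Binary.

(* The N-th tensor power of the vector representation, bracketed to the right;
   the empty tensor product is the trivial crystal. *)
Fixpoint tensor_power (N : nat) : crystal n :=
  if N is N'.+1 then tensor vector_crystal (tensor_power N')
  else trivial_crystal.

(* b_1 (x) ... (x) b_N, for a word b_1 ... b_N of length N *)
Fixpoint pure_tensor (N : nat) (w : seq 'I_n.+1) : tensor_power N :=
  if N is N'.+1 then (head ord0 w, pure_tensor N' (behead w)) else tt.

End Tensor.

Section Tableaux.
Variable n : nat.
Implicit Types (a : 'I_n -> nat) (t : seq (seq 'I_n.+1)).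

(* A tableau is the sequence of its columns, from left to right, each column
   being read from top to bottom. *)

(* Lengths of the columns, from left to right: a_n times n, ..., a_1 times 1. *)
Definition col_lengths a : seq nat :=
  flatten [seq nseq (a i) i.+1 | i <- rev (enum 'I_n)].

(* Box in row r and column c, numbered from 0 *)
Definition is_box t (r c : nat) : bool :=
  (c < size t)%N && (r < size (nth [::] t c))%N.
Definition entry t (r c : nat) : 'I_n.+1 := nth ord0 (nth [::] t c) r.

Definition semistandard t : Prop :=
  (forall r c c', is_box t r c -> is_box t r c' -> (c <= c')%N ->
     (entry t r c <= entry t r c')%N) /\
  (forall r r' c, is_box t r c -> is_box t r' c -> (r < r')%N ->
     (entry t r c < entry t r' c)%N).

Definition ssyt a : set (seq (seq 'I_n.+1)) :=
  [set t | shape t = col_lengths a /\ semistandard t].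

Definition reading_word t : seq 'I_n.+1 := flatten (rev t).

(* |lambda| *)
Definition num_boxes a : nat := sumn (col_lengths a).

Definition tableau_tensor a t : tensor_power n (num_boxes a) :=
  pure_tensor (num_boxes a) (reading_word t).

(* Tableaux of shape lambda, identified with tensors by the column reading; the
   identification is justified by [tableau_tensor_inj] below. *)
Definition T_lambda a : set (tensor_power n (num_boxes a)) :=
  tableau_tensor a @` ssyt a.

Lemma pure_tensor_inj (N : nat) (w w' : seq 'I_n.+1) :
  size w = N -> size w' = N -> pure_tensor N w = pure_tensor N w' -> w = w'.
Proof.
elim: N w w' => [|N IHN] [|x w] [|x' w'] //= [sw] [sw'] [-> eqw].
by rewrite (IHN _ _ sw sw' eqw).
Qed.

Lemma tableau_tensor_inj a : set_inj (ssyt a) (tableau_tensor a).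
Proof.
move=> t t' /set_mem[st _] /set_mem[st' _].
have sz u : shape u = col_lengths a -> size (reading_word u) = num_boxes a.
  by move=> su; rewrite size_flatten /shape map_rev sumn_rev -/(shape u) su.
move=> /(pure_tensor_inj (sz _ st) (sz _ st')) eqw.
rewrite -[t]revK -[t']revK; congr rev; apply: eq_from_flatten_shape => //.
by rewrite /shape !map_rev -/(shape t) -/(shape t') st st'.
Qed.

End Tableaux.

Arguments T_lambda {n} a.

(* Main.v *)
Require Import Defs.
From mathcomp Require Import ssreflect ssrbool ssrfun eqtype ssrnat fintype.
From Stdlib Require Import Relations.
From HB Require Import structures.
From mathcomp Require Import all_boot all_order all_algebra all_classical.
From mathcomp Require Import zify.
From mathcomp.multinomials Require Import freeg.

(* Both crystals are compared with words in the letters 1, ..., n+1.  The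
   variable Y_k(0) is the product of the boxes X_j(k-j), 1 <= j <= k, where
   X_j(m) = Y_j(m) / Y_(j-1)(m+1), and A_i(m)^-1 turns X_i(m) into X_(i+1)(m).
   So the monomials of M(lambda) are fillings of the bottom-justified diagram of
   lambda, known up to the order of the letters in each row, and reading the
   rows from top to bottom, each in decreasing order, identifies M(lambda) with a
   component of the crystal of words.  T(lambda) is another one, through the
   column reading.  A Knuth move applied to the letters at fixed positions is an
   automorphism of the whole crystal of words.  Every highest weight word is
   carried by such moves to the column reading of a tableau all of whose columns
   are 1, 2, ..., k; this tableau is determined by the weight, so some automorphism
   maps one component onto the other. *)

Set Implicit Arguments.
Unset Strict Implicit.
Unset Printing Implicit Defensive.

(** * The crystal of words *)

(* Letters are natural numbers, the letter x standing for x.+1 in {1, ..., n+1};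
   the colour i moves the letter i to i.+1. *)

(** Truncated subtraction is the maximum with 0 in the tensor product rule: $\varepsilon(x\otimes
    w')=\varepsilon(x)+\max(0,\varepsilon(w')-\varphi(x))$, and likewise for [wphi]. *)
Fixpoint weps (i : nat) (w : seq nat) : nat :=
  if w is x :: w' then (x == i.+1) + (weps i w' - (x == i)) else 0.

Fixpoint wphi (i : nat) (w : seq nat) : nat :=
  if w is x :: w' then wphi i w' + ((x == i) - weps i w') else 0.

Fixpoint wf (i : nat) (w : seq nat) : option (seq nat) :=
  if w is x :: w' then
    if weps i w' < (x == i) then Some (i.+1 :: w') else omap (cons x) (wf i w')
  else None.

Fixpoint we (i : nat) (w : seq nat) : option (seq nat) :=
  if w is x :: w' then
    if weps i w' <= (x == i) then if x == i.+1 then Some (i :: w') else None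
    else omap (cons x) (we i w')
  else None.

Lemma weps_cat i u v : weps i (u ++ v) = weps i u + (weps i v - wphi i u).
Proof. elim: u => [|x u IH] /=; rewrite ?IH; [lia | case: (x == i); case: (x == i.+1); lia]. Qed.

Lemma wphi_cat i u v : wphi i (u ++ v) = wphi i v + (wphi i u - weps i v).
Proof. elim: u => [|x u IH] /=; rewrite ?IH ?weps_cat; [lia | case: (x == i); case: (x == i.+1); lia]. Qed.

Lemma wphi_weps i w : wphi i w + count_mem i.+1 w = weps i w + count_mem i w.
Proof. elim: w => //= x w; case: (x == i); case: (x == i.+1); lia. Qed.

Lemma weps_notin i w : i.+1 \notin w -> weps i w = 0.
Proof. by elim: w => //= x w IH; rewrite inE negb_or => /andP[xi /IH ->]; lia. Qed.

Lemma wphi_notin i w : i \notin w -> wphi i w = 0.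
Proof. by elim: w => //= x w IH; rewrite inE negb_or => /andP[xi /IH ->]; lia. Qed.

(** An [i] is cancelled only by an [i.+1] further right, so if no [i] survives, the displayed one
    has its partner in [v]. [weps0_mem] is the mirror image. *)
Lemma wphi0_mem i u v : wphi i (u ++ i :: v) = 0 -> i.+1 \in v.
Proof.
move=> h; apply: contraT => /weps_notin ev.
by move: h; rewrite wphi_cat /=; lia.
Qed.

Lemma weps0_mem i u v : weps i (u ++ i.+1 :: v) = 0 -> i \in u.
Proof.
move=> h; apply: contraT => /wphi_notin eu.
by move: h; rewrite weps_cat /= eu; lia.
Qed.

Lemma weps0_prefix i u v : weps i (u ++ v) = 0 -> weps i u = 0.
Proof. rewrite weps_cat; lia. Qed.

Lemma wphi0_suffix i u v : wphi i (u ++ v) = 0 -> wphi i v = 0.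
Proof. rewrite wphi_cat; lia. Qed.

Lemma wf_cat i u v :
  wf i (u ++ v) = if weps i v < wphi i u then omap (cat^~ v) (wf i u)
                  else omap (cat u) (wf i v).
Proof.
elim: u => [|x u IH] /=; first by case: (wf i v).
rewrite IH weps_cat.
case: (ltnP (weps i u) (x == i)) => h1.
  have -> : (weps i u + (weps i v - wphi i u) < (x == i))
          = (weps i v < wphi i u + ((x == i) - weps i u)) by move: h1; case: (x == i); lia.
  case: ifP => // h2; rewrite ifN; first by case: (wf i v).
  by move: h1 h2; case: (x == i); lia.
rewrite ifN; last by move: h1; case: (x == i); lia.
have -> : (x == i) - weps i u = 0 by move: h1; case: (x == i); lia.
by rewrite addn0; case: ifP => _; [case: (wf i u) | case: (wf i v)].
Qed.

(** The signature rule: the letter that changes is the leftmost uncancelled [i] of [w], equally the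
    rightmost uncancelled [i.+1] of [w']. The conditions on [u] and [v] are the same from either
    side, so one relation describes both operators. *)
Definition step (i : nat) (w w' : seq nat) : Prop :=
  exists u v, [/\ w = u ++ i :: v, w' = u ++ i.+1 :: v, wphi i u = 0 & weps i v = 0].

Lemma step_wf i w w' : step i w w' -> wf i w = Some w'.
Proof. case=> u [v [-> -> hu hv]]; by rewrite wf_cat /= eqxx hv hu. Qed.

Lemma wf_step i w w' : wf i w = Some w' -> step i w w'.
Proof.
elim: w w' => //= x w IH w'; case: ltnP => h.
  have xi : x = i by move: h; case: eqP.
  move=> [<-]; exists [::], w; rewrite xi; split=> //.
  by move: h; case: (x == i) => //; lia.
case: (wf i w) IH => //= w1 /(_ _ erefl) [u [v [e1 e2 hu hv]]] [<-].
exists (x :: u), v; rewrite e1 e2; split=> //=.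
by move: h; rewrite e1 weps_cat /= hu hv; lia.
Qed.

Lemma step_we i w w' : step i w w' -> we i w' = Some w.
Proof.
case=> u [v [-> -> hu hv]].
elim: u hu => [|x u IH] /= hu; first by rewrite hv eqxx.
rewrite IH ?ifN //; last by lia.
rewrite weps_cat /= hv; lia.
Qed.

Lemma we_step i w w' : we i w' = Some w -> step i w w'.
Proof.
elim: w' w => //= x w' IH w; case: leqP => h.
  case: eqP => // xi [<-]; exists [::], w'; rewrite xi; split=> //.
  by move: h; rewrite xi; case: eqP => //; lia.
case: (we i w') IH => //= w1 /(_ _ erefl) [u [v [e1 e2 hu hv]]] [<-].
exists (x :: u), v; rewrite e1 e2; split=> //=.
by move: h; rewrite e2 weps_cat /= hu hv; lia.
Qed.

Lemma wf_None i w : wf i w = None -> wphi i w = 0.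
Proof.
elim: w => //= x w IH; case: ltnP => // h.
by case: (wf i w) IH => // /(_ erefl) ->; lia.
Qed.

Lemma we_None i w : we i w = None -> weps i w = 0.
Proof.
elim: w => //= x w IH; case: leqP => // h; first by move: h; do 2 case: eqP => //; lia.
by case: (we i w) IH => // /(_ erefl) e0; move: h; rewrite e0.
Qed.

Lemma step_wphi i w w' : step i w w' -> wphi i w = (wphi i w').+1.
Proof. by case=> u [v [-> -> hu hv]]; rewrite !wphi_cat /= hu hv eqxx; lia. Qed.

Lemma step_weps i w w' : step i w w' -> weps i w' = (weps i w).+1.
Proof. by case=> u [v [-> -> hu hv]]; rewrite !weps_cat /= hu hv eqxx; lia. Qed.

Lemma step_size i w w' : step i w w' -> size w' = size w.
Proof. by case=> u [v [-> -> _ _]]; rewrite !size_cat. Qed.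

(** * Automorphisms of the crystal of words *)

(** Compatibility with [wphi] and [we] follows: [wphi] is fixed by content and [weps], while [we]
    inverts [wf] and is undefined only where [weps] vanishes. *)
Definition word_aut (g : seq nat -> seq nat) : Prop :=
  [/\ injective g,
      forall w, perm_eq (g w) w,
      forall i w, weps i (g w) = weps i w &
      forall i w, wf i (g w) = omap g (wf i w)].

Lemma word_aut_wphi g i w : word_aut g -> wphi i (g w) = wphi i w.
Proof.
move=> [_ gp ge _]; have := wphi_weps i (g w); have := wphi_weps i w.
by rewrite ge !(permP (gp w)); lia.
Qed.

Lemma word_aut_size g w : word_aut g -> size (g w) = size w.
Proof. by case=> _ gp _ _; exact: perm_size. Qed.

Lemma word_aut_step g i w w' : word_aut g -> step i w w' -> step i (g w) (g w').
Proof. by move=> [_ _ _ gf] /step_wf h; apply: wf_step; rewrite gf h. Qed.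

Lemma word_aut_we g i w : word_aut g -> we i (g w) = omap g (we i w).
Proof.
move=> ga; case h: (we i w) => [w'|] /=; first by apply/step_we/word_aut_step/we_step.
case h': (we i (g w)) => [w'|] //=; move/we_step/step_weps: h'.
by case: ga => _ _ -> _; rewrite (we_None h).
Qed.

Lemma wf_size i w w' : wf i w = Some w' -> size w' = size w.
Proof. by move=> /wf_step/step_size. Qed.

(** The tensor product rule sees a factor only through [weps] and [wphi], which [g] preserves; the
    operators keep lengths, so the cut at [p] is stable. *)
Lemma word_aut_left g p : word_aut g -> word_aut (fun w => g (take p w) ++ drop p w).
Proof.
move=> ga; have [gi gp ge gf] := ga; split.
- move=> w w' /eqP; have eqsz : size w = size w' -> size (g (take p w)) = size (g (take p w')).
    by move=> e; rewrite !(word_aut_size _ ga) !size_take e.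
  move=> /eqP e; have /eqsz e' : size w = size w'.
    by have := congr1 size e; rewrite !size_cat !(word_aut_size _ ga) -!size_cat !cat_take_drop.
  move/eqP: e; rewrite eqseq_cat // => /andP[/eqP/gi e1 /eqP e2].
  by rewrite -(cat_take_drop p w) e1 e2 cat_take_drop.
- by move=> w; rewrite -{3}(cat_take_drop p w) perm_cat2r.
- by move=> i w; rewrite -{3}(cat_take_drop p w) !weps_cat ge (word_aut_wphi _ _ ga).
- move=> i w; rewrite -{3}(cat_take_drop p w) !wf_cat gf (word_aut_wphi _ _ ga).
  have [sp|sp] := leqP (size w) p.
    rewrite (drop_oversize sp) (take_oversize sp) /=.
    case: ifP => _ //; case h: (wf i w) => [w'|] //=.
    by rewrite !cats0 drop_oversize ?take_oversize ?(wf_size h) ?cats0.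
  case: ifP => _.
    case h: (wf i (take p w)) => [w'|] //=.
    have s : size w' = p by rewrite (wf_size h) size_takel // ltnW.
    by rewrite take_cat drop_cat s ltnn subnn take0 drop0 cats0.
  case h: (wf i (drop p w)) => [w'|] //=.
  have s : size (take p w) = p by rewrite size_takel // ltnW.
  by rewrite take_cat drop_cat s ltnn subnn take0 drop0 cats0.
Qed.

Lemma word_aut_right g p : word_aut g -> word_aut (fun w => take p w ++ g (drop p w)).
Proof.
move=> ga; have [gi gp ge gf] := ga; split.
- move=> w w' /eqP; have eqsz : size w = size w' -> size (take p w) = size (take p w').
    by move=> e; rewrite !size_take e.
  move=> /eqP e; have /eqsz e' : size w = size w'.
    by have := congr1 size e; rewrite !size_cat !(word_aut_size _ ga) -!size_cat !cat_take_drop.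
  move/eqP: e; rewrite eqseq_cat // => /andP[/eqP e1 /eqP/gi e2].
  by rewrite -(cat_take_drop p w) e1 e2 cat_take_drop.
- by move=> w; rewrite -{3}(cat_take_drop p w) perm_cat2l.
- by move=> i w; rewrite -{3}(cat_take_drop p w) !weps_cat ge.
- move=> i w; rewrite -{3}(cat_take_drop p w) !wf_cat gf ge.
  have [sp|sp] := leqP (size w) p.
    rewrite (drop_oversize sp) (take_oversize sp) /=.
    case: ifP => _ //; case h: (wf i w) => [w'|] //=.
    by rewrite cats0 drop_oversize ?take_oversize ?(wf_size h).
  case: ifP => _.
    case h: (wf i (take p w)) => [w'|] //=.
    have s : size w' = p by rewrite (wf_size h) size_takel // ltnW.
    by rewrite take_cat drop_cat s ltnn subnn take0 drop0 cats0.
  case h: (wf i (drop p w)) => [w'|] //=.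
  have s : size (take p w) = p by rewrite size_takel // ltnW.
  by rewrite take_cat drop_cat s ltnn subnn take0 drop0 cats0.
Qed.

Definition word_conn (w w' : seq nat) : Prop := exists2 g, word_aut g & g w = w'.

Lemma word_conn_refl w : word_conn w w.
Proof. by exists id => //; split=> // i v; case: (wf i v). Qed.

Lemma word_conn_trans w1 w2 w3 : word_conn w1 w2 -> word_conn w2 w3 -> word_conn w1 w3.
Proof.
move=> [g [gi gp ge gf] <-] [h [hi hp he hf] <-]; exists (h \o g) => //; split=> /=.
- exact: inj_comp.
- by move=> w; rewrite (perm_trans (hp _)).
- by move=> i w; rewrite he.
- by move=> i w; rewrite hf gf; case: (wf i w).
Qed.

Lemma word_conn_catr u w w' : word_conn w w' -> word_conn (u ++ w) (u ++ w').
Proof.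
move=> [g ga <-]; exists (fun v => take (size u) v ++ g (drop (size u) v)).
  exact: word_aut_right.
by rewrite take_size_cat // drop_size_cat.
Qed.

Lemma word_conn_catl u w w' : word_conn w w' -> word_conn (w ++ u) (w' ++ u).
Proof.
move=> [g ga <-]; exists (fun v => g (take (size w) v) ++ drop (size w) v).
  exact: word_aut_left.
by rewrite take_size_cat // drop_size_cat.
Qed.

Lemma word_conn_cons x w w' : word_conn w w' -> word_conn (x :: w) (x :: w').
Proof. exact: (@word_conn_catr [:: x]). Qed.

(* The Knuth relations, written for words read in the order opposite to the
   usual one: xzy ~ zxy if x < y <= z, and yzx ~ yxz if x <= y < z. *)
Definition knuth (w : seq nat) : seq nat :=
  match w with
  | [:: a; b; c] =>
    if (a < c <= b) || (b < c <= a) then [:: b; a; c]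
    else if (c <= a < b) || (b <= a < c) then [:: a; c; b]
    else w
  | _ => w
  end.

Lemma knuthK : involutive knuth.
Proof.
move=> [|a [|b [|c [|d w]]]] //=.
case: ifP => /= h1; first by rewrite ifT //; lia.
case: ifP => /= h2; last by rewrite h1 h2.
by rewrite ifF; [rewrite ifT //; lia | lia].
Qed.

Lemma knuth_perm w : perm_eq (knuth w) w.
Proof.
move: w => [|a [|b [|c [|d w]]]] //=.
case: ifP => _; first by rewrite (perm_catCA [:: b] [:: a] [:: c]).
case: ifP => _ //; by rewrite perm_cons (perm_catC [:: c] [:: b]).
Qed.

Lemma knuth_weps i w : weps i (knuth w) = weps i w.
Proof.
move: w => [|a [|b [|c [|d w]]]] //=.
case: ifP => h1; [|case: ifP => //= h2];
  rewrite /=; case: (a =P i) => ai; case: (b =P i) => bi; case: (c =P i) => ci;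
  case: (a =P i.+1) => ai'; case: (b =P i.+1) => bi'; case: (c =P i.+1) => ci'; rewrite /=; lia.
Qed.

(** For three letters everything depends on their order and on which of them equal [i] or [i.+1]: a
    finite check. *)
Lemma knuth_wf i w : wf i (knuth w) = omap knuth (wf i w).
Proof.
move: w => [|a [|b [|c [|d w]]]].
- by [].
- by rewrite /=; case: ifP.
- by rewrite /=; case: ifP => //; case: ifP.
- rewrite /= /knuth.
  case: (a =P i) => ai; case: (b =P i) => bi; case: (c =P i) => ci;
  case: (a =P i.+1) => ai'; case: (b =P i.+1) => bi'; case: (c =P i.+1) => ci';
  try (exfalso; lia); rewrite ?ai ?bi ?ci ?ai' ?bi' ?ci' /=.
  all: repeat (case: ifP => ? /=); try (exfalso; lia); try done.
(* On longer words [knuth] is the identity, and [wf] keeps the length. *)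
- set v := d :: w; have s : 0 < size v by [].
  have e : forall w', size w' = size [:: a, b, c & v] -> knuth w' = w'.
    by rewrite /v; move=> [|a' [|b' [|c' [|d' w']]]] /=; try lia.
  rewrite e //; case h: (wf i _) => [w'|] //=.
  by rewrite e // (wf_size h).
Qed.

Lemma word_aut_knuth : word_aut knuth.
Proof.
split; [exact: inv_inj knuthK | exact: knuth_perm | exact: knuth_weps | exact: knuth_wf].
Qed.

Lemma word_conn_knuth w : word_conn w (knuth w).
Proof. by exists knuth => //; exact: word_aut_knuth. Qed.

(** * Normal form of highest weight words *)

(** The letter [x] moves left by Knuth moves on triples [[:: j; j.+1; x]]. Each move needs the left
    neighbour as a pivot, which is why the first letter is not passed. *)
Lemma word_conn_down x j m : x <= j ->
  word_conn (j :: iota j.+1 m ++ [:: x]) (j :: x :: iota j.+1 m).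
Proof.
elim: m j => [|m IH] j xj /=; first exact: word_conn_refl.
apply: word_conn_trans (word_conn_cons j (IH j.+1 (leqW xj))) _.
have := word_conn_catl (iota j.+2 m) (word_conn_knuth [:: j; j.+1; x]).
by rewrite /= ltnSn xj !ifN //=; lia.
Qed.

(** Now the pivot is the right neighbour, in triples [[:: j; x; j.+1]]; the second copy of [x] is
    the pivot of the first move. *)
Lemma word_conn_up x j m : j + m = x ->
  word_conn (iota j m ++ [:: x; x]) (x :: iota j m ++ [:: x]).
Proof.
elim: m j => [|m IH] j jx /=; first exact: word_conn_refl.
apply: word_conn_trans (word_conn_cons j (IH j.+1 _)) _; first by lia.
have [t ->] : exists t, iota j.+1 m ++ [:: x] = j.+1 :: t.
  case: m {IH} jx => [|m] jx /=; last by exists (iota j.+2 m ++ [:: x]).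
  by exists [::]; congr cons; lia.
have := word_conn_catl t (word_conn_knuth [:: j; x; j.+1]).
by rewrite /= ifT //; lia.
Qed.

(** The new letter slides past the larger letters until it meets the [x] of the column; one of the
    two copies then slides past the smaller letters. *)
Lemma word_conn_column x k : x < k -> word_conn (iota 0 k ++ [:: x]) (x :: iota 0 k).
Proof.
move=> xk; have -> : iota 0 k = iota 0 x ++ x :: iota x.+1 (k - x.+1).
  by rewrite -[X in iota 0 X](subnKC (ltnW xk)) iotaD -(subnSK xk).
rewrite -catA /=.
apply: word_conn_trans (word_conn_catr _ (word_conn_down _ (leqnn x))) _.
have := word_conn_catl (iota x.+1 (k - x.+1)) (@word_conn_up x 0 x (add0n x)).
by rewrite /= -!catA.
Qed.

(** For weakly increasing [s], the reading of the highest weight tableau whose column lengths, from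
    right to left, are [s]. *)
Definition hw_word (s : seq nat) : seq nat := flatten [seq iota 0 k | k <- s].

Lemma hw_word_cat s1 k s2 :
  hw_word (s1 ++ k :: s2) = hw_word s1 ++ iota 0 k ++ hw_word s2.
Proof. by rewrite /hw_word map_cat flatten_cat. Qed.

Lemma word_conn_hw_word x s : all (ltn x) s -> word_conn (hw_word s ++ [:: x]) (x :: hw_word s).
Proof.
elim: s => [|k s IH] /=; first by move=> _; exact: word_conn_refl.
move=> /andP[xk /IH h]; rewrite /hw_word /= -catA.
apply: word_conn_trans (word_conn_catr _ h) _.
by have := word_conn_catl (hw_word s) (word_conn_column xk); rewrite -catA.
Qed.

Lemma count_hw_word y s : count_mem y (hw_word s) = count (ltn y) s.
Proof.
elim: s => //= k s IH; rewrite /hw_word /= count_cat -/(hw_word s) IH.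
by rewrite count_uniq_mem ?iota_uniq // mem_iota.
Qed.

(** The letter [y] occurs once in each column longer than [y]. This recovers the shape from the
    weight. *)
Lemma count_hw_wordS y s :
  count_mem y (hw_word s) = count_mem y.+1 (hw_word s) + count_mem y.+1 s.
Proof. by rewrite !count_hw_word; elim: s => //= k s ->; rewrite /=; case: eqP; lia. Qed.

Lemma split_last_mem x s : sorted leq s -> x \in s ->
  exists s1 s2, s = s1 ++ x :: s2 /\ all (ltn x) s2.
Proof.
elim: s => //= k s IH ps; rewrite inE.
have [/(IH (path_sorted ps))[s1 [s2 [-> h]]] _|xs] := boolP (x \in s).
  by exists (k :: s1), s2.
rewrite orbF => /eqP xk; exists [::], s; rewrite xk; split=> //.
apply/allP => z zs /=; rewrite ltn_neqAle (allP (order_path_min leq_trans ps)) // andbT.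
by apply: contraNneq xs => zk; rewrite xk zk.
Qed.

(** Induction on the last letter: the prefix is put in normal form, and the letter slides left
    through longer columns until it extends a column or starts one. *)
Lemma yamanouchi_conn w : (forall i, weps i w = 0) ->
  exists s, [/\ sorted leq s, all (ltn 0) s & word_conn w (hw_word s)].
Proof.
elim/last_ind: w => [|w x IH] yw; first by exists [::]; split=> //; exact: word_conn_refl.
rewrite -cats1 in yw *.
have [|s [ss s0 ws]] := IH; first by move=> i; exact: weps0_prefix (yw i).
have wx : word_conn (w ++ [:: x]) (hw_word s ++ [:: x]) by exact: word_conn_catl.
case: x yw wx => [|y] yw wx.
  exists (1 :: s); split=> //.
    by rewrite /= path_min_sorted //; apply/allP => z /(allP s0).
  exact: word_conn_trans wx (word_conn_hw_word s0).
(* The letter [y.+1] must be cancelled by a [y] of the prefix, and [wphi y] of the normal form is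
   the number of columns of length [y.+1]. *)
have ys : y.+1 \in s.
  have := yw y; rewrite weps_cat /= eqxx.
  case: ws => g ga gw; rewrite -(word_aut_wphi _ _ ga) gw.
  case: ga => _ _ ge _; have := wphi_weps y (hw_word s).
  rewrite (count_hw_wordS y) -gw ge (weps0_prefix (yw y)) -has_pred1 has_count; lia.
(* The last column of length [y.+1] is taken: the later ones are longer, so the letter slides past
   them and the lengths stay sorted. *)
have [s1 [s2 [e h]]] := split_last_mem ss ys.
exists (s1 ++ y.+2 :: s2); split.
- move: ss; rewrite e !(sorted_pairwise leq_trans) !pairwise_cat /= !allrel_consr.
  move=> /and3P[/andP[a1 a2] -> /andP[_ ->]]; rewrite a2 h !andbT.
  by apply/allP => z /(allP a1); lia.
- by move: s0; rewrite e !all_cat.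
- apply: word_conn_trans wx _; rewrite e !hw_word_cat -!catA.
  apply: word_conn_catr; rewrite -(addn1 y.+1) iotaD -catA.
  exact/word_conn_catr/word_conn_hw_word.
Qed.

(** * Tableaux *)

Lemma flatten_split (T : Type) (R : seq (seq T)) u x v : flatten R = u ++ x :: v ->
  exists R1 u' v' R2, [/\ R = R1 ++ (u' ++ x :: v') :: R2,
    u = flatten R1 ++ u' & v = v' ++ flatten R2].
Proof.
elim: R u => [|r R IH] u /=; first by case: u.
elim: r u => [|y r IHr] u /=.
  by move=> /IH[R1 [u' [v' [R2 [-> -> ->]]]]]; exists ([::] :: R1), u', v', R2.
case: u => [[-> <-]|z u [-> /IHr[R1 [u' [v' [R2 [e -> ->]]]]]]].
  by exists [::], [::], r, R.
case: R1 e => [|r1 R1] /= [-> ->]; first by exists [::], (z :: u'), v', R2.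
by exists ((z :: r1) :: R1), u', v', R2.
Qed.

Lemma sorted_replace (T : Type) (e : rel T) s1 x x' s2 :
  (forall s y, s1 = rcons s y -> e y x -> e y x') ->
  (forall y s, s2 = y :: s -> e x y -> e x' y) ->
  sorted e (s1 ++ x :: s2) -> sorted e (s1 ++ x' :: s2).
Proof.
move=> h1 h2; have p2 : path e x s2 -> path e x' s2.
  by case: s2 h2 => //= y s h2 /andP[/(h2 _ _ erefl) -> ->].
case/lastP: s1 h1 => [|s y] h1 //=.
rewrite -!cats1 -!catA /=; case: s h1 => [|z s] h1 /=.
  by move=> /andP[/(h1 [::] y erefl) -> /p2 ->].
rewrite !cat_path /= => /andP[-> /and3P[-> exy /p2 ->]].
by rewrite (h1 (z :: s) y erefl exy).
Qed.

(* [colle c d]: the column d may stand immediately to the left of c. *)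
Definition colle (c d : seq nat) : bool :=
  (size c <= size d) && all (fun r => nth 0 d r <= nth 0 c r) (iota 0 (size c)).

Lemma colleP c d : reflect
  (size c <= size d /\ forall r, r < size c -> nth 0 d r <= nth 0 c r) (colle c d).
Proof.
apply: (iffP andP) => [][h1]; first move/allP.
  by move=> h2; split=> // r rc; apply: h2; rewrite mem_iota.
by move=> h2; split=> //; apply/allP => r; rewrite mem_iota => /h2.
Qed.

(* Semistandard tableaux, the columns being listed from right to left. *)
Definition is_tableau (cols : seq (seq nat)) : bool :=
  all (sorted ltn) cols && sorted colle cols.

Lemma sorted_ltn_split u x v :
  sorted ltn (u ++ x :: v) = [&& sorted ltn u, all (ltn^~ x) u, all (ltn x) v,
    allrel ltn u v & sorted ltn v].
Proof.
rewrite !(sorted_pairwise ltn_trans) pairwise_cat /= allrel_consr.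
by case: pairwise; case: all; case: all; case: allrel; case: pairwise.
Qed.

(** Raising [i] can only conflict with an [i.+1] below it or an [i] immediately to its right; the
    conditions on [v] and on [u] exclude these in turn. *)
Lemma step_tableau i cols w' : is_tableau cols -> step i (flatten cols) w' ->
  exists cols', [/\ is_tableau cols', shape cols' = shape cols & w' = flatten cols'].
Proof.
move=> /andP[sc cc] [u [v [e0 -> hu hv]]].
have [C1 [u' [v' [C2 [ec eu ev]]]]] := flatten_split e0; clear e0.
exists (C1 ++ (u' ++ i.+1 :: v') :: C2).
rewrite ec /shape !map_cat !flatten_cat /= !size_cat eu ev -!catA; split=> //.
move: sc cc; rewrite ec /is_tableau !all_cat /= => /and3P[-> s1 ->].
have := s1; rewrite sorted_ltn_split => /and5P[su ui iv uv sv].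
(* An [i.+1] below would need an [i] between it and the changed letter, but the column is strict. *)
have nv : i.+1 \notin v'.
  apply/negP => /splitPr e; case: e ev iv sv => a b ev iv sv.
  move: hv; rewrite ev -catA /= => /weps0_mem ia.
  by have := allP iv i; rewrite mem_cat ia /= ltnn => /(_ isT).
have iv' : all (ltn i.+1) v'.
  apply/allP => z zv; have := allP iv z zv.
  by have : z != i.+1 by [apply: contraNneq nv => <-]; rewrite /=; lia.
have -> : sorted ltn (u' ++ i.+1 :: v').
  rewrite sorted_ltn_split su sv uv iv' !andbT /=.
  by apply/allP => z /(allP ui) /=; lia.
apply: sorted_replace.
- move=> s d es /colleP; rewrite !size_cat /= => -[szd h].
  apply/colleP; rewrite !size_cat; split=> // r rd; have := h r rd; rewrite !nth_cat.
  case: (ltngtP r (size u')) => [||er]; first 1 last.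
  + by move=> ru; rewrite -(subnSK ru).
  + rewrite er subnn /= leq_eqVlt => /orP[/eqP ed|] //.
    rewrite -er in ed.
    (* An [i] to the right in the same row is cancelled within [u], hence by an [i.+1] lower in [d].
       The left neighbour of that letter lies below the changed entry, so it exceeds [i.+1]: a row
       would decrease. *)
    have : wphi i (flatten s ++ (take r d ++ i :: drop r.+1 d) ++ u') = 0.
      rewrite [X in _ ++ (_ ++ X :: _) ++ _]ed -drop_nth // cat_take_drop catA -flatten_rcons.
      by rewrite -es -eu.
    rewrite -!catA /= catA => /wphi0_mem; rewrite mem_cat => /orP[]; last first.
      by move/(allP ui) => /=; lia.
    move=> /(nthP 0)[j]; rewrite size_drop nth_drop => jd ej.
    have rj : r.+1 + j < size d by rewrite -ltn_subRL.
    have jv : j < size v' by lia.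
    have := h _ rj; rewrite ej nth_cat ifN; last by lia.
    have -> : r.+1 + j - size u' = j.+1 by lia.
    have := allP iv' _ (mem_nth 0 jv); rewrite /=; lia.
  + by [].
- move=> d s es /colleP; rewrite !size_cat /= => -[szd h].
  apply/colleP; rewrite !size_cat; split=> // r rd; have := h r rd; rewrite !nth_cat.
  case: (ltnP r (size u')) => //.
  by case: (r - size u') => //=; lia.
Qed.

(** The mirror image: lowering [i.+1] can only conflict with an [i] above it or an [i.+1]
    immediately to its left. *)
Lemma step_tableau_rev i cols w : is_tableau cols -> step i w (flatten cols) ->
  exists cols', [/\ is_tableau cols', shape cols' = shape cols & w = flatten cols'].
Proof.
move=> /andP[sc cc] [u [v [-> e0 hu hv]]].
have [C1 [u' [v' [C2 [ec eu ev]]]]] := flatten_split e0; clear e0.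
exists (C1 ++ (u' ++ i :: v') :: C2).
rewrite ec /shape !map_cat !flatten_cat /= !size_cat eu ev -!catA; split=> //.
move: sc cc; rewrite ec /is_tableau !all_cat /= => /and3P[-> s1 ->].
have := s1; rewrite sorted_ltn_split => /and5P[su ui iv uv sv].
have nu : i \notin u'.
  apply/negP => /splitPr e; case: e eu ui su uv {s1 ec} => a b eu ui su uv.
  move: hu; rewrite eu catA => /wphi0_mem ib.
  by have := allP ui i.+1; rewrite mem_cat inE ib !orbT /= ltnn => /(_ isT).
have ui' : all (ltn^~ i) u'.
  apply/allP => z zu; have := allP ui z zu; rewrite /= ltnS leq_eqVlt => /orP[/eqP zi|//].
  by rewrite -zi zu in nu.
have -> : sorted ltn (u' ++ i :: v').
  rewrite sorted_ltn_split su sv uv ui' !andbT /=.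
  by apply/allP => z /(allP iv) /=; lia.
apply: sorted_replace.
- move=> s d es /colleP; rewrite !size_cat /= => -[szd h].
  apply/colleP; rewrite !size_cat; split=> // r rd; have := h r rd; rewrite !nth_cat.
  case: (ltnP r (size u')) => //.
  by case: (r - size u') => //=; lia.
- move=> d s es /colleP; rewrite !size_cat /= => -[szd h].
  apply/colleP; rewrite !size_cat; split=> // r rc; have := h r rc; rewrite !nth_cat.
  case: (ltngtP r (size u')) => [||er]; first 1 last.
  + by move=> ru; rewrite -(subnSK ru).
  + rewrite er subnn /= leq_eqVlt => /orP[/eqP ed|] //.
    rewrite -er in ed.
    (* An [i.+1] to the left in the same row is cancelled by an [i] higher in [d], whose right
       neighbour lies above the changed entry and so is less than [i]. *)
    have : weps i ((v' ++ take r d) ++ i.+1 :: (drop r.+1 d ++ flatten s)) = 0.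
      rewrite -[X in _ ++ X :: _]ed -cat_cons -drop_nth; last exact: leq_trans rc szd.
      by rewrite -catA (catA (take _ _)) cat_take_drop; move: hv; rewrite ev es.
    move/weps0_mem; rewrite mem_cat => /orP[].
      by move/(allP iv) => /=; lia.
    move=> /(nthP 0)[j]; rewrite size_takel; last exact: ltnW (leq_trans rc szd).
    move=> jr.
    have ju : j < size u' by rewrite -er.
    rewrite nth_take // => ej; have := h j; rewrite ej nth_cat -er jr => /(_ (ltn_addr _ jr)).
    have := allP ui' _ (mem_nth 0 ju); rewrite /=; lia.
  + by [].
Qed.

(** Induction on the columns from right to left and, inside a column, on the rows from the top. *)
Lemma tableau_yamanouchi cols : is_tableau cols -> sorted leq (shape cols) ->
  (forall i, weps i (flatten cols) = 0) -> cols = [seq iota 0 k | k <- shape cols].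
Proof.
elim/last_ind: cols => // cols d IH.
rewrite -cats1 /is_tableau all_cat /shape map_cat flatten_cat /= cats0.
move=> /andP[/and3P[sc sd _] cc] ss yw.
have tc : is_tableau cols by rewrite /is_tableau sc (prefix_sorted (prefix_prefix _ _) cc).
have {IH} ecols : cols = [seq iota 0 k | k <- shape cols].
  apply: IH => //; last by move=> i; exact: weps0_prefix (yw i).
  exact: prefix_sorted (prefix_prefix _ _) ss.
rewrite map_cat -ecols /=; congr (_ ++ [:: _]).
apply: (@eq_from_nth _ 0); rewrite ?size_iota // => r.
elim/ltn_ind: r => r IH rd; rewrite nth_iota // add0n.
have dr : r <= nth 0 d r.
  case: r IH rd => // r /(_ r (leqnn _)) IH rd.
  have er : nth 0 d r = r by rewrite (IH (ltnW rd)) nth_iota 1?ltnW.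
  by have := sorted_ltn_nth ltn_trans 0 sd r r.+1; rewrite er !inE rd ltnW // ltnSn; apply.
apply/eqP; rewrite eqn_leq dr andbT leqNgt; apply/negP => xr.
case ex: (nth 0 d r) xr dr => [//|x]; rewrite ltnS => rx _.
(* An entry [x.+1] with [r <= x] needs an [x] before it. The entries above it are less than [r], so
   some earlier column is longer than [x]. *)
have := yw x; rewrite -(cat_take_drop r d) (drop_nth 0 rd) ex catA => /weps0_mem.
rewrite mem_cat => /orP[]; last first.
  move=> /(nthP 0)[j]; rewrite size_takel; [move=> jr | exact: ltnW].
  have jd := ltn_trans jr rd; rewrite nth_take // IH // nth_iota // => jx.
  by move: jr; rewrite -(add0n j) jx ltnNge rx.
rewrite ecols => /flatten_mapP[k ks]; rewrite mem_iota add0n => /andP[_ xk].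
case/lastP: cols ks ecols cc ss {sc yw tc} => // cols l.
rewrite -!cats1 -!catA /= /shape !map_cat /= => ks ecols cc ss.
have el : l = iota 0 (size l).
  by move/(congr1 (last [::])): ecols; rewrite !last_cat /=.
have kl : k <= size l.
  move: ks ss; rewrite mem_cat inE => /orP[kc|/eqP -> //].
  rewrite (sorted_pairwise leq_trans) !pairwise_cat => /and3P[_ /and3P[/allrelP h _ _] _].
  exact: h kc (mem_head _ _).
(* The neighbouring column [l] is at least as long, and its entry [r] in row [r] bounds that of
   [d]. *)
have : sorted colle [:: l; d] := suffix_sorted (suffix_suffix _ _) cc.
rewrite /= andbT => /colleP[_ /(_ r)].
by rewrite ex el size_iota nth_iota; lia.
Qed.

(** * Monomials as products of boxes *)

Lemma geq_trans : transitive geq.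
Proof. by move=> y x z xy yz; apply: leq_trans yz xy. Qed.

Lemma sorted_geq_split u x v :
  sorted geq (u ++ x :: v) = [&& sorted geq u, all (leq x) u, all (geq x) v,
    allrel geq u v & sorted geq v].
Proof.
rewrite !(sorted_pairwise geq_trans) pairwise_cat /= allrel_consr.
by case: pairwise; case: all; case: all; case: allrel; case: pairwise.
Qed.

(** In a decreasing row every [i.+1] precedes every [i], so nothing cancels. *)
Lemma sorted_geq_wphi_weps i r : sorted geq r ->
  wphi i r = count_mem i r /\ weps i r = count_mem i.+1 r.
Proof.
elim: r => //= x r IH pr; have [-> ->] := IH (path_sorted pr).
have [xi|xi] := eqVneq x i; last by split; case: (x == i.+1); lia.
rewrite xi in pr *.
have -> : count_mem i.+1 r = 0.
  apply/count_memPn/negP => /(allP (order_path_min geq_trans pr)) /=; lia.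
by split; lia.
Qed.

Lemma sorted_geq_notin i u v : wphi i u = 0 -> sorted geq (u ++ i :: v) -> i \notin u.
Proof.
move=> + s; move: s; rewrite sorted_geq_split => /and5P[su ui iv _ _] hu.
apply/negP => /splitPr e; case: e ui su hu => a b _ + /wphi0_mem ib.
by rewrite sorted_geq_split => /and5P[_ _ /allP/(_ _ ib) /=]; rewrite ltnn.
Qed.

Lemma sorted_geq_down i u v : weps i v = 0 -> sorted geq (u ++ i.+1 :: v) ->
  sorted geq (u ++ i :: v).
Proof.
move=> hv; rewrite !sorted_geq_split => /and5P[-> ui iv -> sv]; rewrite sv !andbT /=.
apply/andP; split; first by apply/allP => z /(allP ui) /=; lia.
apply/allP => z zv; have := allP iv z zv; rewrite /= leq_eqVlt => /orP[/eqP ez|//].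
move: zv; rewrite ez => /splitPr e; case: e sv hv iv => a b.
rewrite sorted_geq_split => /and5P[_ h _ _ _] /weps0_mem ia.
by have := allP h i ia; rewrite /= ltnn.
Qed.

Lemma sorted_geq_up i u v : wphi i u = 0 -> sorted geq (u ++ i :: v) ->
  sorted geq (u ++ i.+1 :: v).
Proof.
move=> hu s; have := sorted_geq_notin hu s; move: s.
rewrite !sorted_geq_split => /and5P[-> ui iv -> ->] nu; rewrite !andbT /=.
apply/andP; split; last by apply/allP => z /(allP iv) /=; lia.
apply/allP => z zu; have := allP ui z zu; rewrite /= leq_eqVlt => /orP[/eqP ez|//].
by rewrite ez zu in nu.
Qed.

Import Order.TTheory GRing.Theory Num.Theory.
Local Open Scope classical_set_scope.
Local Open Scope ring_scope.

(** * Partial exponent sums against the signature rule *)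

Definition word_wt (i : nat) (w : seq nat) : int :=
  (count_mem i w)%:Z - (count_mem i.+1 w)%:Z.

Lemma word_wt_cat i u v : word_wt i (u ++ v) = word_wt i u + word_wt i v.
Proof. rewrite /word_wt !count_cat; lia. Qed.

Lemma word_wt_wphi_weps i w : word_wt i w = (wphi i w)%:Z - (weps i w)%:Z.
Proof. by rewrite /word_wt; have := wphi_weps i w; lia. Qed.

(* The exponent of Y_(i+1) in the monomial attached to [rows] (see [monom]
   below), summed over all positions <= m. *)
Fixpoint psum (i : nat) (rows : seq (seq nat)) (m : int) : int :=
  if rows is r :: rs then
    (if (size rs)%:Z <= m then (count_mem i r)%:Z else 0)
    - (if (size rs)%:Z + 1 <= m then (count_mem i.+1 r)%:Z else 0)
    + psum i rs m
  else 0.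

Lemma psum_lt i R1 R2 m : m < (size R2)%:Z -> psum i (R1 ++ R2) m = psum i R2 m.
Proof.
move=> h; elim: R1 => //= r R1 ->; rewrite size_cat.
by rewrite !ifN ?subr0 ?add0r //; lia.
Qed.

Lemma psum_ge i rows m : (size rows)%:Z <= m -> psum i rows m = word_wt i (flatten rows).
Proof.
elim: rows => //= r rows IH h; rewrite word_wt_cat IH ?ifT //; lia.
Qed.

(** At its own height a row contributes only its letters [i]: the inverse variables coming from
    [i.+1] sit one position higher. *)
Lemma psum_at i r rs :
  psum i (r :: rs) (size rs)%:Z = (count_mem i r)%:Z + word_wt i (flatten rs).
Proof. by rewrite /= lexx ifN ?subr0 ?psum_ge //; lia. Qed.

(** Below the top row induction applies, above it the sum is the whole weight, and at its height the
    bound is the tensor product formula for [wphi]. *)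
Lemma psum_le i rows m : all (sorted geq) rows -> psum i rows m <= (wphi i (flatten rows))%:Z.
Proof.
elim: rows m => // r rs IH m sr; have /andP[/(sorted_geq_wphi_weps i)[pr er] srs] := sr.
have := wphi_cat i r (flatten rs).
have [mr|mr|->] := ltgtP m (size rs)%:Z.
- by rewrite (psum_lt i [:: r]) //=; have := IH m srs; lia.
- rewrite psum_ge ?word_wt_wphi_weps /=; lia.
- by rewrite psum_at word_wt_wphi_weps /= -pr; lia.
Qed.

(** The maximum is first attained at the height of the row containing the changed letter; this
    identifies [n_f]. *)
Lemma psum_step i R1 u v R2 : all (sorted geq) (R1 ++ (u ++ i :: v) :: R2) ->
  wphi i (flatten R1 ++ u) = 0%N -> weps i (v ++ flatten R2) = 0%N ->
  psum i (R1 ++ (u ++ i :: v) :: R2) (size R2)%:Z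
    = (wphi i (flatten (R1 ++ (u ++ i :: v) :: R2)))%:Z /\
  forall m, m < (size R2)%:Z -> psum i (R1 ++ (u ++ i :: v) :: R2) m
    < (wphi i (flatten (R1 ++ (u ++ i :: v) :: R2)))%:Z.
Proof.
rewrite all_cat /= => /and3P[_ s s2] hu hv.
have nu := sorted_geq_notin (wphi0_suffix hu) s.
have e : (wphi i (flatten (R1 ++ (u ++ i :: v) :: R2))) = (wphi i (v ++ flatten R2)).+1.
  by rewrite flatten_cat /= -catA cat_cons catA wphi_cat hu /= eqxx hv; lia.
rewrite e; split=> [|m hm].
  rewrite psum_lt; last by rewrite ltz_nat /=.
  rewrite psum_at !count_cat /= (count_memPn nu) eqxx.
  have := word_wt_wphi_weps i (v ++ flatten R2); rewrite hv word_wt_cat [word_wt i v]/word_wt.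
  have -> : count_mem i.+1 v = 0%N; last by rewrite !subr0 add0n -add1n !PoszD => <-; rewrite -addrA.
  apply/count_memPn/negP => iv; move: s; rewrite sorted_geq_split => /and5P[_ _ h _ _].
  by have := allP h _ iv; rewrite /= ltnn.
rewrite -cat_rcons psum_lt //; have := psum_le i m s2; rewrite wphi_cat.
have := weps_cat i v (flatten R2); lia.
Qed.

(** * Extremal partial sums of an arbitrary monomial *)

Lemma zmax_eq (A : set int) z : A z -> ubound A z -> zmax A = z.
Proof.
move=> Az ub; apply: xget_unique => // y [Ay uy].
by apply/eqP; rewrite eq_le (ub _ Ay) (uy _ Az).
Qed.

Lemma zmin_eq (A : set int) z : A z -> lbound A z -> zmin A = z.
Proof.
move=> Az lb; apply: xget_unique => // y [Ay ly].
by apply/eqP; rewrite eq_le (lb _ Ay) (ly _ Az).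
Qed.

Section MonomialSums.
Variable n : nat.
Implicit Types (M : monomial n) (i : 'I_n) (m : int) (P : set int).

Definition expo_sum i P M : int := \sum_(k \in P) expo M i k.

Lemma expo_sumE i P M (s : seq int) : uniq s ->
  (forall k, k \notin s -> expo M i k = 0) ->
  expo_sum i P M = \sum_(k <- s | k \in P) expo M i k.
Proof.
move=> us h; rewrite (@bigfs _ _ _ _ s (mem P)) //; last by move=> k _ /h.
by rewrite /expo_sum; congr (\sum_(k \in _) _); rewrite set_mem_set.
Qed.

Lemma expo_dom M i k : k \notin [seq z.2 | z <- dom M] -> expo M i k = 0.
Proof.
move=> h; apply: coeff_outdom; apply: contra h => h.
by apply/mapP; exists (i, k).
Qed.

Lemma expo_sumB i P : {morph expo_sum i P : M M' / M - M'}.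
Proof.
move=> M M'.
pose s := undup ([seq z.2 | z <- dom M] ++ [seq z.2 | z <- dom M']).
have us : uniq s by exact: undup_uniq.
have h k : k \notin s -> expo M i k = 0 /\ expo M' i k = 0.
  by rewrite mem_undup mem_cat negb_or => /andP[/expo_dom -> /expo_dom ->].
rewrite !(@expo_sumE _ _ _ s) //; try by move=> k /h[].
  by rewrite -sumrB; apply: eq_bigr => k _; rewrite /expo coeffB.
by move=> k /h[]; rewrite /expo coeffB => -> ->; rewrite subr0.
Qed.

HB.instance Definition _ i P :=
  GRing.isZmodMorphism.Build (monomial n) int (expo_sum i P) (@expo_sumB i P).

Lemma expo_sum_U i P (j : 'I_n) (k : int) :
  expo_sum i P (<< (j, k) >> : monomial n) = ((j == i) && (k \in P))%:R.
Proof.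
rewrite (@expo_sumE _ _ _ [:: k]) //; last first.
  move=> k'; rewrite inE /expo coeffU mul1r xpair_eqE eq_sym => /negbTE ->.
  by rewrite andbF.
rewrite big_mkcond big_seq1 /expo coeffU mul1r xpair_eqE eqxx andbT.
by case: (k \in P); rewrite ?andbT ?andbF.
Qed.

Lemma expo_sum_Y i P k m :
  expo_sum i P (Y n k m) = ((i.+1 == k) && (m \in P))%:R.
Proof.
rewrite /Y raddf_sum /=; under eq_bigr do rewrite expo_sum_U.
case: (eqVneq i.+1 k) => [e|ne] /=.
  rewrite (bigD1 i) /=; last by rewrite e.
  rewrite eqxx /= big1 ?addr0 // => j /andP[_ /negbTE ->] //.
rewrite big1 // => j /eqP e; case: eqP => //= ji.
by rewrite -e ji eqxx in ne.
Qed.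

Lemma expo_sum_A i P m :
  expo_sum i P (A_ i m) = (m \in P)%:R + ((m + 1)%R \in P)%:R.
Proof.
rewrite /A_ !raddfB raddfD /= !expo_sum_Y eqxx /=.
have [-> ->] : (i.+1 == i = false)%N /\ (i.+1 == i.+2 = false)%N by split; lia.
by rewrite /= !subr0.
Qed.

Lemma mem_le m k : (k \in [set z : int | z <= m]) = (k <= m).
Proof. by apply/idP/idP; rewrite inE. Qed.

Lemma sum_leE M i m : sum_le M i m = expo_sum i [set k | k <= m] M.
Proof. by []. Qed.

Lemma expo_sum_compl M i m :
  sum_le M i m + sum_gt M i m = expo_sum i setT M.
Proof.
rewrite -[sum_gt M i m]/(expo_sum i [set k | m < k] M) sum_leE.
rewrite !(@expo_sumE _ _ _ (undup [seq z.2 | z <- dom M])) ?undup_uniq //;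
  try by move=> k; rewrite mem_undup => /expo_dom.
rewrite [RHS](bigID (fun k => k <= m)) /=; congr (_ + _); apply: eq_bigl => k.
  by rewrite in_setT mem_le.
by rewrite in_setT -ltNge; apply/idP/idP; rewrite inE.
Qed.

Lemma expo_bound M i : exists K : nat,
  forall k, expo M i k != 0 -> - K%:Z <= k <= K%:Z.
Proof.
exists (\sum_(k <- [seq z.2 | z <- dom M]) `|k|)%N => k h.
have : k \in [seq z.2 | z <- dom M] by apply: contraR h => /expo_dom ->.
move=> ks; set K := (\sum_(_ <- _) _)%N.
have : (`|k| <= K)%N by rewrite /K (big_rem k) //= leq_addr.
by rewrite -ler_norml -abszE lez_nat.
Qed.

Lemma sum_le_bound M i : exists K : nat,
  (forall m, m < - K%:Z -> sum_le M i m = 0) /\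
  (forall m, K%:Z <= m -> sum_le M i m = expo_sum i setT M).
Proof.
have [K h] := expo_bound M i; exists K; split=> m hm.
  by apply: fsbig1 => k /= km; have [//|/h] := eqVneq (expo M i k) 0; lia.
apply: fsbig_widen => // k [_ /= km]; have [//|/h] := eqVneq (expo M i k) 0.
by move/negP: km; lia.
Qed.

Lemma sum_le_max M i : exists m, forall m', sum_le M i m' <= sum_le M i m.
Proof.
have [K [h0 h1]] := sum_le_bound M i.
(* The window runs from [- K - 1] to [K]; its two ends stand for the constant tails. *)
pose f (j : 'I_(K + K).+2) := sum_le M i (j%:Z - K%:Z - 1).
case: (@arg_maxP _ _ _ ord0 xpredT f erefl) => j _ hj.
exists (j%:Z - K%:Z - 1) => m'.
have [hm|hm] := ltP m' (- K%:Z).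
  by rewrite (h0 m') // -(h0 (0%:Z - K%:Z - 1)); [exact: (hj ord0) | lia].
have [hm'|hm'] := leP K%:Z m'.
  by rewrite (h1 m') // -(h1 ((K + K).+1%:Z - K%:Z - 1)); [exact: (hj ord_max) | lia].
have k : (`|(m' + K%:Z + 1)%R| < (K + K).+2)%N by lia.
have := hj (Ordinal k) isT; rewrite /f /=.
by have -> : `|(m' + K%:Z + 1)%R|%N%:Z - K%:Z - 1 = m' by lia.
Qed.

Lemma mon_phi_eq M i m : (forall m', sum_le M i m' <= sum_le M i m) ->
  mon_phi i M = sum_le M i m.
Proof. by move=> h; apply: zmax_eq; [exists m | move=> _ [m' _ <-]]. Qed.

Lemma mon_phiP M i : exists m, mon_phi i M = sum_le M i m /\
  forall m', sum_le M i m' <= mon_phi i M.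
Proof. by have [m h] := sum_le_max M i; exists m; rewrite (mon_phi_eq h). Qed.

(** The sum beyond [m] is the total minus the sum up to [m], so both maxima are attained at the same
    positions. *)
Lemma mon_epsE M i : mon_eps i M = mon_phi i M - expo_sum i setT M.
Proof.
have [m [e h]] := mon_phiP M i; apply: zmax_eq.
  by exists m => //; rewrite e -(expo_sum_compl _ _ m); lia.
by move=> _ [m' _ <-]; have := h m'; rewrite -(expo_sum_compl _ _ m'); lia.
Qed.

Lemma mon_eps_ge0 M i : 0 <= mon_eps i M.
Proof.
have [m [_ h]] := mon_phiP M i; have [K [_ h1]] := sum_le_bound M i.
by rewrite mon_epsE subr_ge0 -(h1 K%:Z).
Qed.

Lemma n_f_eq M i l : mon_phi i M = sum_le M i l ->
  (forall m, m < l -> sum_le M i m < mon_phi i M) -> n_f i M = l.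
Proof.
move=> e h; apply: zmin_eq => //= m /= em; rewrite leNgt; apply/negP => /h.
by rewrite -em ltxx.
Qed.

Lemma n_fP M i : 0 < mon_phi i M -> mon_phi i M = sum_le M i (n_f i M) /\
  forall m, m < n_f i M -> sum_le M i m < mon_phi i M.
Proof.
move=> h; have [m [e hm]] := mon_phiP M i; have [K [h0 _]] := sum_le_bound M i.
(* The partial sums vanish left of [- K], so a positive maximum has a first position. *)
have low m' : mon_phi i M = sum_le M i m' -> - K%:Z <= m'.
  by move=> e'; rewrite leNgt; apply/negP => /h0 e0; rewrite e' e0 in h.
have ex : exists j : nat, mon_phi i M == sum_le M i (j%:Z - K%:Z).
  exists `|(m + K%:Z)%R|%N; rewrite (_ : _%:Z - _ = m) ?e //; have := low m e; lia.
case: (ex_minnP ex) => j /eqP ej jmin.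
suff hl m' : m' < j%:Z - K%:Z -> sum_le M i m' < mon_phi i M.
  by have -> : n_f i M = j%:Z - K%:Z by exact: n_f_eq.
move=> mj; rewrite lt_neqAle hm andbT; apply/negP => /eqP e'.
have lm := low _ (esym e').
have := jmin `|(m' + K%:Z)%R|%N; rewrite (_ : _%:Z - _ = m'); last by lia.
by rewrite e' eqxx => /(_ isT); lia.
Qed.

(** Subtracting [A_ i l] lowers the partial sums by 1 at [l] and by 2 beyond it, while those before
    [l] were already below the maximum. So [l] becomes the last position of the new maximum, which
    is [n_e]. *)
Lemma mon_f_e M M' i : mon_f i M = Some M' -> mon_e i M' = Some M.
Proof.
rewrite /mon_f; case: ifP => // /n_fP[]; set l := n_f i M => el hl [<-].
have [_ [_ hphi]] := mon_phiP M i.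
have S m : sum_le (M - A_ i l) i m = sum_le M i m - ((l <= m)%R%:R + (l + 1 <= m)%R%:R).
  by rewrite !sum_leE raddfB /= expo_sum_A !mem_le.
have hphi' : mon_phi i (M - A_ i l) = sum_le (M - A_ i l) i l.
  apply: mon_phi_eq => m; rewrite !S -el lexx; have := hl m; have := hphi m.
  by case: (ltgtP m l) => [||->]; lia.
have en : n_e i (M - A_ i l) = l.
  apply: zmax_eq => //= m /=; rewrite hphi' leNgt => e; apply/negP => lm.
  move: e; rewrite !S -el lexx; have := hphi m; lia.
have eps_gt : 0 < mon_eps i (M - A_ i l).
  have := mon_eps_ge0 M i; rewrite !mon_epsE hphi' S -el lexx raddfB /= expo_sum_A.
  by rewrite !in_setT; lia.
by rewrite /mon_e eps_gt en subrK.
Qed.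

Lemma mon_wtE M j : mon_wt M ord0 j = expo_sum j setT M.
Proof.
rewrite /mon_wt summxE (bigD1 j) //= [X in _ + X]big1 => [|k kj].
  by rewrite !mxE eqxx mulr1 addr0.
by rewrite !mxE eqSS eq_sym (negbTE (_ : k != j :> nat)) ?mulr0.
Qed.

End MonomialSums.

Lemma size_count_mem n r : all (geq n) r ->
  size r = (\sum_(i < n.+1) count_mem (i : nat) r)%N.
Proof.
elim: r => [|x r IH] /=; first by rewrite big1.
move=> /andP[xn /IH ->]; rewrite big_split /=.
rewrite [X in (X + _)%N](bigD1 (Ordinal (xn : (x < n.+1)%N))) //= eqxx.
rewrite [X in (_ + X + _)%N]big1 => [|j].
  by rewrite addn0 add1n.
by rewrite -val_eqE /= eq_sym => /negbTE ->.
Qed.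

(** The length supplies the count of the last letter [n], which the exponent sums of the colours
    below [n] do not give directly. *)
Lemma sorted_geq_eq n r r' : sorted geq r -> sorted geq r' ->
  all (geq n) r -> all (geq n) r' -> size r = size r' ->
  (forall i, (i < n)%N -> count_mem i r = count_mem i r') -> r = r'.
Proof.
move=> sr sr' rn rn' e h; apply: (sorted_eq geq_trans) => //.
  by move=> x y; rewrite /= -eqn_leq eq_sym => /eqP.
apply/allP => x _ /=; apply/eqP; case: (ltngtP x n) => [/h //|xn|->].
  have out s : all (geq n) s -> count_mem x s = 0%N.
    by move=> sn; apply/count_memPn/negP => /(allP sn) /=; rewrite leqNgt xn.
  by rewrite !out.
move: e; rewrite (size_count_mem rn) (size_count_mem rn') !big_ord_recr /=.
rewrite (eq_bigr (fun i : 'I_n => count_mem (i : nat) r')) => [/addnI //|i _].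
exact: h.
Qed.

(** From the bottom row up: the partial sum at the height of a row, minus the weight of the rows
    below, counts its letters [i]. *)
Lemma psum_inj n rows rows' : shape rows = shape rows' ->
  all (sorted geq) rows -> all (sorted geq) rows' ->
  all (geq n) (flatten rows) -> all (geq n) (flatten rows') ->
  (forall i m, (i < n)%N -> m < (size rows)%:Z -> psum i rows m = psum i rows' m) ->
  rows = rows'.
Proof.
elim: rows rows' => [|r rs IH] [|r' rs'] //= [er ers] /andP[sr srs] /andP[sr' srs'].
rewrite !all_cat => /andP[rn rsn] /andP[rn' rsn'] h.
have esz : size rs = size rs' by have := congr1 size ers; rewrite !size_map.
have {}h i m : (i < n)%N -> m < (size rs).+1%:Z ->
  psum i (r :: rs) m = psum i (r' :: rs') m by exact: h.
have ers' : rs = rs'.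
  apply: IH => // i m i_n hm; have hm' : m < (size rs')%:Z by rewrite -esz.
  rewrite -(psum_lt i [:: r] hm) -(psum_lt i [:: r'] hm'); apply: h => //.
  by apply: lt_trans hm _; rewrite ltz_nat.
rewrite -ers' in h *; congr cons; apply: (sorted_geq_eq sr sr' rn rn') => // i i_n.
have := h i (size rs)%:Z i_n; rewrite !psum_at ltz_nat ltnSn => /(_ isT) /addIr.
by case.
Qed.

(** * The monomial of a filling *)

Section MonomialRows.
Variable n : nat.

(* The box with letter x.+1 in row m, counted from the bottom *)
Definition box (x : nat) (m : int) : monomial n := Y n x.+1 m - Y n x (m + 1).

(* Rows are listed from top to bottom; the last one has height 0. *)
Fixpoint monom (rows : seq (seq nat)) : monomial n :=
  if rows is r :: rs then \sum_(x <- r) box x (size rs)%:Z + monom rs else 0.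

Lemma monom_replace R1 r r' R2 :
  monom (R1 ++ r' :: R2) = monom (R1 ++ r :: R2)
    + (\sum_(x <- r') box x (size R2)%:Z - \sum_(x <- r) box x (size R2)%:Z).
Proof.
elim: R1 => [|r1 R1 IH] /=; first by rewrite [RHS]addrC addrA subrK.
by rewrite IH addrA !size_cat.
Qed.

Lemma box_A (i : 'I_n) m : box i.+1 m - box i m = - A_ i m.
Proof. by rewrite /box /A_ !opprD !opprK [RHS]addrC -!addrA; congr (_ + _); rewrite addrCA. Qed.

Lemma expo_sum_box (i : 'I_n) P x m : expo_sum i P (box x m) =
  ((x == i) && (m \in P))%:R - ((x == i.+1) && ((m + 1)%R \in P))%:R.
Proof. by rewrite /box raddfB /= !expo_sum_Y eqSS (eq_sym (i : nat)) (eq_sym i.+1). Qed.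

Lemma expo_sum_boxs (i : 'I_n) P (r : seq nat) m : expo_sum i P (\sum_(x <- r) box x m) =
  (if m \in P then (count_mem (i : nat) r)%:Z else 0)
  - (if (m + 1)%R \in P then (count_mem i.+1 r)%:Z else 0).
Proof.
rewrite raddf_sum /=; elim: r => [|x r IH]; first by rewrite big_nil !if_same.
rewrite big_cons IH expo_sum_box /=; case: (m \in P); case: (_ \in P);
  rewrite ?andbT ?andbF; lia.
Qed.

Lemma sum_le_monom (i : 'I_n) rows m : sum_le (monom rows) i m = psum i rows m.
Proof.
rewrite sum_leE; elim: rows => [|r rs IH] /=; first by rewrite raddf0.
by rewrite raddfD /= IH expo_sum_boxs !mem_le.
Qed.

Lemma expo_sum_monom (i : 'I_n) rows :
  expo_sum i setT (monom rows) = word_wt i (flatten rows).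
Proof.
elim: rows => [|r rs IH] /=; first by rewrite raddf0.
by rewrite raddfD /= IH expo_sum_boxs !in_setT word_wt_cat.
Qed.

(** By [psum_step], [n_f] is the height of the changed row, and [box_A] says that the change of
    letter subtracts [A_] at that height. *)
Lemma monom_step (i : 'I_n) rows w' : all (sorted geq) rows ->
  step i (flatten rows) w' ->
  exists rows', [/\ all (sorted geq) rows', shape rows' = shape rows,
    w' = flatten rows' & mon_f i (monom rows) = Some (monom rows')] /\
    mon_phi i (monom rows) = (wphi i (flatten rows))%:Z.
Proof.
move=> s [u [v [e0 -> hu hv]]].
have [R1 [u' [v' [R2 [ec eu ev]]]]] := flatten_split e0; clear e0.
subst u v rows.
exists (R1 ++ (u' ++ i.+1 :: v') :: R2).
have [hl hlt] := psum_step s hu hv.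
have hphi : mon_phi i (monom (R1 ++ (u' ++ (i : nat) :: v') :: R2))
    = sum_le (monom (R1 ++ (u' ++ (i : nat) :: v') :: R2)) i (size R2)%:Z.
  by apply: mon_phi_eq => m; rewrite !sum_le_monom hl psum_le.
have ephi := hphi; rewrite sum_le_monom hl in ephi.
split=> //; split.
- move: s; rewrite !all_cat /= => /and3P[-> s ->].
  by rewrite (sorted_geq_up (wphi0_suffix hu) s).
- by rewrite /shape !map_cat /= !size_cat.
- by rewrite flatten_cat /= -!catA.
rewrite /mon_f; have -> : 0 < mon_phi i (monom (R1 ++ (u' ++ (i : nat) :: v') :: R2)).
  by rewrite ephi flatten_cat /= -catA cat_cons catA wphi_cat /= hv eqxx; lia.
rewrite (n_f_eq hphi) => [|m hm]; last by rewrite ephi sum_le_monom hlt.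
rewrite [in RHS](monom_replace _ (u' ++ (i : nat) :: v')) -box_A.
congr Some; congr (_ + _).
rewrite !big_cat /= !big_cons.
move: (box i.+1 _) (box i _) => p q.
by rewrite [in RHS]opprD [RHS]addrACA subrr add0r [in RHS]opprD [RHS]addrACA subrr addr0.
Qed.

Lemma step_up_rows i rows w : all (sorted geq) rows -> step i w (flatten rows) ->
  exists rows', [/\ all (sorted geq) rows', shape rows' = shape rows & w = flatten rows'].
Proof.
move=> s [u [v [-> e0 hu hv]]].
have [R1 [u' [v' [R2 [ec eu ev]]]]] := flatten_split e0; clear e0.
exists (R1 ++ (u' ++ i :: v') :: R2); rewrite eu ev ec in hv s *; split.
- move: s; rewrite !all_cat /= => /and3P[-> s ->].
  by rewrite (sorted_geq_down (weps0_prefix hv) s).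
- by rewrite /shape !map_cat /= !size_cat.
- by rewrite flatten_cat /= -!catA.
Qed.

Lemma mon_phi_monom (i : 'I_n) rows : all (sorted geq) rows ->
  mon_phi i (monom rows) = (wphi i (flatten rows))%:Z.
Proof.
move=> s; case e: (wf i (flatten rows)) => [w'|].
  by have [rows' []] := monom_step s (wf_step e).
(* The maximum is 0, attained at position -1, below all the rows. *)
have p0 := wf_None e; rewrite (@mon_phi_eq _ _ _ (- 1)).
  by rewrite p0 sum_le_monom -[rows]cats0 psum_lt.
move=> m; rewrite !sum_le_monom -[rows in X in _ <= X]cats0 [X in _ <= X]psum_lt //=.
by rewrite -[0]/(0%N%:Z) -p0 psum_le.
Qed.

Lemma mon_eps_monom (i : 'I_n) rows : all (sorted geq) rows ->
  mon_eps i (monom rows) = (weps i (flatten rows))%:Z.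
Proof.
move=> s; rewrite mon_epsE mon_phi_monom // expo_sum_monom word_wt_wphi_weps; lia.
Qed.

Lemma monom_inj rows rows' : shape rows = shape rows' ->
  all (sorted geq) rows -> all (sorted geq) rows' ->
  all (geq n) (flatten rows) -> all (geq n) (flatten rows') ->
  monom rows = monom rows' -> rows = rows'.
Proof.
move=> es s s' rn rn' e; apply: (psum_inj es s s' rn rn') => i m i_n _.
by rewrite -!(sum_le_monom (Ordinal i_n)) e.
Qed.

Lemma monom_rev_iota (R : nat -> seq nat) k :
  monom [seq R m | m <- rev (iota 0 k)] = \sum_(m < k) \sum_(x <- R m) box x m%:Z.
Proof.
elim: k => [|k IH]; first by rewrite big_ord0.
rewrite -addn1 iotaD rev_cat /= add0n addn1 big_ord_recr /= -IH size_map size_rev size_iota.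
by rewrite addrC.
Qed.

(* A column of height j.+1 filled with 1, ..., j.+1 *)
Lemma sum_box_column (j : 'I_n) : \sum_(m < n | (m <= j)%N) box (j - m) m%:Z = Y n j.+1 0.
Proof.
rewrite -(big_ord_widen n (fun m => box (j - m) m%:Z) (ltn_ord j)) /=.
pose g m := Y n (j.+1 - m) m%:Z.
rewrite (eq_bigr (fun m : 'I_j.+1 => - (g m.+1 - g m))) => [|m _].
  rewrite sumrN -(big_mkord xpredT (fun m => g m.+1 - g m)) telescope_sumr // opprB.
  have Y0 m : Y n 0 m = 0 by rewrite /Y big_pred0.
  by rewrite /g subnn subn0 Y0 subr0.
by rewrite /g /box opprB subSS subSn ?leq_ord // intS (addrC 1).
Qed.

Lemma hw_rows (a : 'I_n -> nat) : exists rows, [/\ all (sorted geq) rows,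
  all (gtn n) (flatten rows) & monom rows = mon_hw a].
Proof.
(* Row [m] of the bottom-justified diagram: a column of length [j.+1] holds [0, ..., j] from top to
   bottom, hence [j - m] at height [m]. *)
pose R m := sort geq (flatten [seq nseq (a j) (j - m)%N | j : 'I_n <- enum 'I_n & (m <= j)%N]).
exists [seq R m | m <- rev (iota 0 n)]; split.
- apply/allP => _ /mapP[m _ ->]; apply: sort_sorted => x y; exact: leq_total.
- apply/allP => x /flatten_mapP[m _]; rewrite mem_sort => /flatten_mapP[j _];
  rewrite mem_nseq => /andP[_ /eqP ->] /=; by rewrite (leq_ltn_trans (leq_subr _ _)).
rewrite monom_rev_iota /mon_hw.
rewrite (eq_bigr (fun m : 'I_n => \sum_(j < n | (m <= j)%N) box (j - m) m%:Z *+ a j)).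
  rewrite (exchange_big_dep xpredT) //=; apply: eq_bigr => j _.
  by rewrite -sum_box_column -sumrMnl.
move=> m _; rewrite (perm_big _ (permEl (perm_sort _ _))) big_flatten big_map big_filter.
rewrite big_enum_cond /=; apply: eq_bigr => j _.
by rewrite big_nseq -Monoid.iteropE.
Qed.

End MonomialRows.

(** * Tensors as words *)

Lemma string_length_eq (T : Type) (op : T -> option T) (l : T -> nat) :
  (forall x, op x = None -> l x = 0%N) ->
  (forall x y, op x = Some y -> l x = (l y).+1) ->
  forall x, string_length op x = (l x)%:Z.
Proof.
move=> h0 h1 x.
have iterSome k y : iter k.+1 (obind op) (Some y) = iter k (obind op) (op y).
  by rewrite iterSr.
have iterNone k : iter k (obind op) None = None by elim: k => //= k ->.
have it k y : (iter k (obind op) (Some y) <> None) <-> (k <= l y)%N.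
  elim: k y => [|k IH] y; first by [].
  rewrite iterSome; case e: (op y) => [y'|]; first by rewrite IH (h1 _ _ e).
  by rewrite iterNone (h0 _ e).
apply: zmax_eq; first by exists (l x) => //; apply/it.
by move=> _ [k -> /it]; rewrite lez_nat.
Qed.

Section TensorWords.
Variable n : nat.

Fixpoint word_of (N : nat) : tensor_power n N -> seq nat :=
  match N return tensor_power n N -> seq nat with
  | 0 => fun=> [::]
  | N'.+1 => fun b => val (b.1 : 'I_n.+1) :: @word_of N' b.2
  end.

Lemma word_of_inj N : injective (@word_of N).
Proof.
elim: N => [[] [] //|N IH] [x b] [y c] /= [/val_inj exy /IH ebc].
by congr pair.
Qed.

Lemma size_word_of N (b : tensor_power n N) : size (word_of b) = N.
Proof. by elim: N b => //= N IH [x b] /=; rewrite IH. Qed.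

Lemma word_of_le N (b : tensor_power n N) : all (geq n) (word_of b).
Proof. by elim: N b => //= N IH [x b] /=; rewrite IH andbT -ltnS. Qed.

Lemma word_of_pure N (w : seq 'I_n.+1) : size w = N ->
  word_of (pure_tensor N w) = map val w.
Proof. by elim: N w => [|N IH] [|x w] //= [/IH ->]. Qed.

Lemma vector_phi (i : 'I_n) (x : 'I_n.+1) :
  string_length (vect_f i) x = ((val x == i) : nat)%:Z.
Proof.
rewrite (@string_length_eq _ _ (fun x : 'I_n.+1 => (val x == i) : nat)) // => y;
  rewrite /vect_f -val_eqE /=; first by case: eqP.
move=> z; case: eqP => // _ [<-] /=; rewrite /bump /=; lia.
Qed.

Lemma word_of_wt N (b : tensor_power n N) j : wt b ord0 j = word_wt j (word_of b).
Proof.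
elim: N b => [|N IH] /=; first by case; rewrite mxE.
case=> x b; rewrite /tens_wt /= mxE IH /vect_wt /fund_weight !mxE /word_wt /=.
by rewrite !eqSS (eq_sym (val x)) (eq_sym (val x)) /=; lia.
Qed.

Lemma word_of_crystal N (i : 'I_n) (b : tensor_power n N) :
  [/\ eps i b = (weps i (word_of b))%:Z,
      phi i b = (wphi i (word_of b))%:Z,
      omap (@word_of N) (kash_e i b) = we i (word_of b) &
      omap (@word_of N) (kash_f i b) = wf i (word_of b)].
Proof.
elim: N b => [|N IH] //=.
have He (b : tensor_power n N.+1) : omap (@word_of N.+1) (kash_e i b) = we i (word_of b).
  case: b => x b /=; have [eb pb Ee Ef] := IH b.
  rewrite /tens_e /= eb vector_phi lez_nat; case: ifP => _.
    rewrite /vect_e -val_eqE /= /bump /= add1n; by case: eqP.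
  by rewrite -Ee; case: (kash_e i b).
have Hf (b : tensor_power n N.+1) : omap (@word_of N.+1) (kash_f i b) = wf i (word_of b).
  case: b => x b /=; have [eb pb Ee Ef] := IH b.
  rewrite /tens_f /= eb vector_phi ltz_nat; case: ifP => [h|_].
    have xi : val x = i by move: h; case: eqP.
    by rewrite /vect_f -val_eqE /= xi eqxx /= /bump /= add1n.
  by rewrite -Ef; case: (kash_f i b).
move=> b; split; [| |exact: He|exact: Hf].
- rewrite (@string_length_eq _ _ (fun b : tensor_power n N.+1 => weps i (word_of b))) //.
    by move=> c e; apply: we_None; rewrite -He /= e.
  by move=> c c' e; apply/step_weps/we_step; rewrite -He /= e.
- rewrite (@string_length_eq _ _ (fun b : tensor_power n N.+1 => wphi i (word_of b))) //.
    by move=> c e; apply: wf_None; rewrite -Hf /= e.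
  by move=> c c' e; apply/step_wphi/wf_step; rewrite -Hf /= e.
Qed.

Lemma word_of_surj N (w : seq nat) : size w = N -> all (geq n) w ->
  exists b : tensor_power n N, word_of b = w.
Proof.
move=> sw aw; exists (pure_tensor N (map inord w)); rewrite word_of_pure ?size_map //.
rewrite -map_comp map_id_in // => x xw /=; rewrite inordK // ltnS.
exact: (allP aw).
Qed.

End TensorWords.

(* Tableaux inside the tensor power *)
Local Close Scope ring_scope.

Lemma colle_trans : transitive colle.
Proof.
move=> d c e /colleP[s1 h1] /colleP[s2 h2]; apply/colleP.
split=> [|r rc]; first exact: leq_trans s1 s2.
by apply: leq_trans (h1 r rc); apply/h2/(leq_trans rc).
Qed.

Lemma sorted_col_lengths n (a : 'I_n -> nat) : sorted leq (rev (col_lengths a)).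
Proof.
rewrite rev_sorted -/geq (sorted_pairwise geq_trans) /col_lengths.
have : pairwise (fun i j : 'I_n => j < i) (rev (enum 'I_n)).
  rewrite -sorted_pairwise; last by move=> i j k /= ji ki; apply: ltn_trans ki ji.
  by rewrite rev_sorted; have := iota_ltn_sorted 0 n; rewrite -val_enum_ord sorted_map.
elim: (rev _) => //= i s IH /andP[ai /IH pw]; rewrite pairwise_cat pw andbT.
apply/andP; split; last by elim: (a i) => //= k ->; rewrite andbT all_nseq /= leqnn orbT.
apply/allrelP => x y; rewrite mem_nseq => /andP[_ /eqP ->] /flatten_mapP[j js].
by rewrite mem_nseq => /andP[_ /eqP ->] /=; exact: leqW (allP ai _ js).
Qed.

Lemma count_col_lengths n (a : 'I_n -> nat) (i : 'I_n) :
  count_mem i.+1 (rev (col_lengths a)) = a i.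
Proof.
rewrite count_rev /col_lengths count_flatten -map_comp map_rev sumn_rev.
rewrite sumnE big_map big_enum /= (bigD1 i) //= count_nseq /= eqxx mul1n.
rewrite big1 ?addn0 // => j ji; rewrite count_nseq /= eqSS.
by rewrite (negbTE (_ : j != i :> nat)).
Qed.

(** [is_tableau] compares neighbours only; transitivity, with column lengths decreasing to the
    right, extends this to all pairs. *)
Lemma semistandardP n (a : 'I_n -> nat) (t : seq (seq 'I_n.+1)) :
  shape t = col_lengths a -> semistandard t <-> is_tableau (map (map val) (rev t)).
Proof.
move=> st; have := sorted_col_lengths a; rewrite -st rev_sorted => sst.
have szt c c' : c <= c' -> c' < size t -> size (nth [::] t c') <= size (nth [::] t c).
  rewrite leq_eqVlt => /orP[/eqP -> //|cc'] ct.
  have h := sorted_ltn_nth (leT := fun x y => y <= x)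
    (fun y x z h1 h2 => leq_trans h2 h1) 0 sst.
  have ct' := ltn_trans cc' ct.
  by have := h c c'; rewrite !inE size_map !(nth_map [::]) //; apply.
have nthv (c : seq 'I_n.+1) r : r < size c -> nth 0 (map val c) r = nth ord0 c r :> nat.
  by move=> h; rewrite (nth_map ord0).
rewrite /is_tableau map_rev all_rev all_map rev_sorted sorted_map; split.
  move=> [hr hc]; apply/andP; split.
    apply/(all_nthP [::]) => c ct /=; apply/(sortedP 0) => r; rewrite size_map => rc.
    rewrite !nthv ?(ltnW rc) //; apply: (hc r r.+1 c) => //; rewrite /is_box ct //=.
    exact: ltnW.
  apply/(sortedP [::]) => c ct /=; apply/colleP; rewrite !size_map.
  split=> [|r rc]; first exact: szt.
  have rc' := leq_trans rc (szt c c.+1 (leqnSn c) ct).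
  by rewrite !nthv //; apply: hr; rewrite // /is_box ?ct ?(ltnW ct).
move=> /andP[/(all_nthP [::]) sc sr]; split.
  move=> r c c' /andP[ct rc] /andP[ct' rc'].
  rewrite leq_eqVlt => /orP[/eqP -> //|cc'].
  have h := sorted_ltn_nth _ [::] sr.
  have /colleP[_ /(_ r)] := h (fun y x z h1 h2 => colle_trans h2 h1) c c' ct ct' cc'.
  by rewrite size_map !nthv //; apply.
move=> r r' c /andP[ct rc] /andP[_ rc'] rr'.
have := sorted_ltn_nth ltn_trans 0 (sc c ct).
by move=> /(_ r r'); rewrite !inE size_map !nthv //; apply.
Qed.

Lemma T_lambdaP n (a : 'I_n -> nat) (b : tensor_power n (num_boxes a)) :
  T_lambda a b <-> exists cols, [/\ is_tableau cols, shape cols = rev (col_lengths a) &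
    word_of b = flatten cols].
Proof.
have sz u : shape u = col_lengths a -> size (@reading_word n u) = num_boxes a.
  by move=> su; rewrite size_flatten /shape map_rev sumn_rev -/(shape u) su.
split.
  move=> [t [st /(semistandardP st) tt] <-].
  exists (map (map val) (rev t)); split=> //.
    rewrite /shape -map_comp map_rev -st; congr rev.
    by apply: eq_map => c /=; rewrite size_map.
  by rewrite /tableau_tensor word_of_pure ?sz // /reading_word map_flatten.
move=> [cols [tc sc wb]].
have colsK : map (map val) (map (map (@inord n)) cols) = cols.
  rewrite -map_comp map_id_in // => c cc /=; rewrite -map_comp map_id_in // => x xc /=.
  rewrite inordK // ltnS; apply: (allP (word_of_le b)); rewrite wb.
  by apply/flattenP; exists c.
pose t := rev (map (map (@inord n)) cols).
have st : shape t = col_lengths a.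
  rewrite -[RHS]revK -sc /t /shape map_rev -!map_comp; congr rev.
  by apply: eq_map => c /=; rewrite size_map.
exists t; first by split=> //; apply/(semistandardP st); rewrite revK colsK.
apply: word_of_inj; rewrite /tableau_tensor word_of_pure ?sz //.
by rewrite /reading_word map_flatten /t revK colsK.
Qed.

(** * The isomorphism *)

Local Open Scope ring_scope.

Section HighestWeight.
Variables (n : nat) (a : 'I_n -> nat).

Lemma expo_sum_hw (i : 'I_n) P :
  expo_sum i P (mon_hw a) = if 0 \in P then (a i)%:Z else 0.
Proof.
rewrite /mon_hw raddf_sum (bigD1 i) //= big1 => [|j ji];
  rewrite raddfMn /= expo_sum_Y eqSS.
  by rewrite eqxx addr0; case: (0 \in P); rewrite /= ?mul0rn // mulr1n natz.
by rewrite eq_sym (negbTE (_ : j != i :> nat)) // mul0rn.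
Qed.

Lemma mon_eps_hw (i : 'I_n) : mon_eps i (mon_hw a) = 0.
Proof.
have S m : sum_le (mon_hw a) i m = if 0 <= m then (a i)%:Z else 0.
  by rewrite sum_leE expo_sum_hw mem_le.
rewrite mon_epsE expo_sum_hw in_setT (@mon_phi_eq _ _ _ 0) S ?subrr // => m.
by rewrite !S; case: ifP.
Qed.

(** Since [mon_eps] vanishes, the row reading is a highest weight word with some normal form
    [hw_word l]; the weight then forces [l]. *)
Lemma hw_conn rows : all (sorted geq) rows -> all (gtn n) (flatten rows) ->
  monom n rows = mon_hw a -> word_conn (flatten rows) (hw_word (rev (col_lengths a))).
Proof.
move=> s rn e.
have [|l [sl l0 [g ga gw]]] := @yamanouchi_conn (flatten rows).
  move=> i; case: (ltnP i n) => [i_n|n_i].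
    have := mon_eps_monom (Ordinal i_n) s; rewrite e mon_eps_hw /=; lia.
  by apply/weps_notin/negP => /(allP rn) /=; lia.
suff <- : l = rev (col_lengths a) by exists g.
apply: (sorted_eq leq_trans) (sorted_col_lengths a) _ => //.
  by move=> x y; rewrite -eqn_leq => /eqP.
have cnt i : count_mem i (hw_word l) = count_mem i (flatten rows).
  by rewrite -gw; case: ga => _ /(_ (flatten rows)) /permP.
apply/allP => x _ /=; apply/eqP; case: x => [|i].
  have -> : count_mem 0%N l = 0%N by apply/count_memPn/negP => /(allP l0).
  apply/esym/count_memPn; rewrite mem_rev; apply/negP => /flatten_mapP[j _].
  by rewrite mem_nseq andbF.
have := count_hw_wordS i l; rewrite !cnt; case: (ltnP i n) => [i_n|n_i].
  have := expo_sum_monom (Ordinal i_n) rows; rewrite e expo_sum_hw in_setT /word_wt /=.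
  rewrite (count_col_lengths a (Ordinal i_n)) => E1 E2; apply/eqP.
  by rewrite -eqz_nat E1 E2 PoszD addrAC subrr add0r.
have -> : count_mem i (flatten rows) = 0%N.
  by apply/count_memPn/negP => /(allP rn) /=; lia.
have -> : count_mem i.+1 (rev (col_lengths a)) = 0%N; last first.
  by move=> /esym/eqP; rewrite addn_eq0 => /andP[_ /eqP ->].
apply/count_memPn; rewrite mem_rev; apply/negP => /flatten_mapP[j _].
by rewrite mem_nseq => /andP[_ /eqP [ij]]; move: n_i; rewrite ij leqNgt ltn_ord.
Qed.

End HighestWeight.

Lemma step_geq n (i : 'I_n) w w' : step i w w' -> all (geq n) w = all (geq n) w'.
Proof.
move=> [u [v [-> -> _ _]]]; rewrite !all_cat /=.
by have := ltn_ord i; case: (all _ u); case: (all _ v) => //=; lia.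
Qed.

Lemma T_lambda_f n (a : 'I_n -> nat) i (b b' : tensor_power n (num_boxes a)) :
  T_lambda a b -> kash_f i b = Some b' -> T_lambda a b'.
Proof.
move=> /T_lambdaP[cols [tc sc wb]] e; have [_ _ _] := word_of_crystal i b.
rewrite e wb => /esym/wf_step/(step_tableau tc)[cols' [tc' sc' wb']].
by apply/T_lambdaP; exists cols'; rewrite sc'.
Qed.

Lemma T_lambda_e n (a : 'I_n -> nat) i (b b' : tensor_power n (num_boxes a)) :
  T_lambda a b -> kash_e i b = Some b' -> T_lambda a b'.
Proof.
move=> /T_lambdaP[cols [tc sc wb]] e; have [_ _ Ee _] := word_of_crystal i b.
move: Ee; rewrite e wb => /esym/we_step/(step_tableau_rev tc)[cols' [tc' sc' wb']].
by apply/T_lambdaP; exists cols'; rewrite sc'.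
Qed.

Lemma T_lambda_hw n (a : 'I_n -> nat) (b : tensor_power n (num_boxes a)) :
  T_lambda a b -> (forall i, kash_e i b = None) ->
  word_of b = hw_word (rev (col_lengths a)).
Proof.
move=> /T_lambdaP[cols [tc sc wb]] e; rewrite wb /hw_word -sc; congr flatten.
apply: tableau_yamanouchi => //; first by rewrite sc sorted_col_lengths.
move=> i; rewrite -wb; case: (ltnP i n) => [i_n|n_i].
  have [_ _ Ee _] := word_of_crystal (Ordinal i_n) b.
  by apply: we_None; move: Ee; rewrite e.
by apply/weps_notin/negP => /(allP (word_of_le b)) /=; lia.
Qed.

Lemma tableau_iota s : sorted leq s -> is_tableau [seq iota 0 k | k <- s].
Proof.
move=> ss; apply/andP; split.
  by apply/allP => _ /mapP[k _ ->]; exact: iota_ltn_sorted.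
rewrite sorted_map; apply: sub_sorted ss => k l kl /=; apply/colleP.
rewrite !size_iota; split=> // r rk.
by rewrite !nth_iota // (leq_trans rk).
Qed.

(** The termination measure for climbing to a highest weight element. *)
Lemma step_sumn i w w' : step i w w' -> sumn w' = (sumn w).+1.
Proof. by move=> [u [v [-> -> _ _]]]; rewrite !sumn_cat /=; lia. Qed.

Section Isomorphism.
Variables (n : nat) (a : 'I_n -> nat) (sh : seq nat) (g : seq nat -> seq nat).
Hypothesis ga : word_aut g.

Definition good_rows (rows : seq (seq nat)) : Prop :=
  [/\ all (sorted geq) rows, all (geq n) (flatten rows) & shape rows = sh].

(** The graph of the isomorphism, kept as a relation because the rows are not computed from [M]. The
    fixed shape [sh] makes it one-to-one. *)
Definition related (M : monomial_crystal n) (b : tensor_power n (num_boxes a)) : Prop :=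
  exists rows, [/\ good_rows rows, monom n rows = M & word_of b = g (flatten rows)].

Lemma related_fun M b b' : related M b -> related M b' -> b = b'.
Proof.
move=> [rows [[s r h] e wb]] [rows' [[s' r' h'] e' wb']]; apply: word_of_inj.
by rewrite wb wb' (monom_inj _ s s' r r') ?h ?e.
Qed.

Lemma related_inj M M' b : related M b -> related M' b -> M = M'.
Proof.
move=> [rows [[s r h] <- wb]] [rows' [[s' r' h'] <- wb']]; congr monom.
case: ga => gi _ _ _; apply: eq_from_flatten_shape; last by rewrite h.
by apply: gi; rewrite -wb.
Qed.

Definition orel (x : option (monomial_crystal n))
    (y : option (tensor_power n (num_boxes a))) : Prop :=
  match x, y with
  | Some M, Some b => related M b
  | None, None => True
  | _, _ => False
  end.

Lemma related_crystal M b (i : 'I_n) : related M b ->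
  [/\ wt b = wt M, eps i b = eps i M, phi i b = phi i M,
    orel (kash_e i M) (kash_e i b) & orel (kash_f i M) (kash_f i b)].
Proof.
move=> [rows [[s r h] <- wb]]; have [eb pb Ee Ef] := word_of_crystal i b.
have [gi gp ge gf] := ga.
split.
- apply/rowP => j; rewrite word_of_wt wb /= mon_wtE expo_sum_monom /word_wt.
  by rewrite !(permP (gp _)).
- by rewrite eb wb ge /= mon_eps_monom.
- by rewrite pb wb (word_aut_wphi _ _ ga) /= mon_phi_monom.
- case e: (we i (flatten rows)) => [w1|].
    (* [mon_e] is not computed directly: [mon_f] sends [monom n rows1] back to [M], and [mon_f_e]
       inverts this. *)
    have st := we_step e; have [rows1 [s1 h1 e1]] := step_up_rows s st.
    rewrite e1 in st; have [rows2 [[s2 h2 e2 f2] _]] := monom_step s1 st.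
    have er : rows2 = rows by apply: eq_from_flatten_shape; rewrite // h2.
    rewrite er in f2; rewrite /= (mon_f_e f2).
    move: Ee; rewrite wb (word_aut_we _ _ ga) e /=; case: (kash_e i b) => //= b' [eb'].
    exists rows1; split=> //; last by rewrite eb' e1.
    by split; rewrite ?h1 // (step_geq st).
  move: Ee; rewrite wb (word_aut_we _ _ ga) e /= /mon_e mon_eps_monom // (we_None e) /=.
  by case: (kash_e i b).
- case e: (wf i (flatten rows)) => [w1|].
    have st := wf_step e; have [rows2 [[s2 h2 e2 f2] _]] := monom_step s st.
    rewrite /= f2; move: Ef; rewrite wb gf e /=; case: (kash_f i b) => //= b' [eb'].
    exists rows2; split=> //; last by rewrite eb' e2.
    by split; rewrite ?h2 // -e2 -(step_geq st).
  move: Ef; rewrite wb gf e /= /mon_f mon_phi_monom // (wf_None e) /=.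
  by case: (kash_f i b).
Qed.

Hypothesis hw_related : exists2 b0, related (mon_hw a) b0 &
  word_of b0 = hw_word (rev (col_lengths a)).
Hypothesis hw_T : forall b, related (mon_hw a) b -> T_lambda a b.

(** The property spreads along arrows in both directions from [mon_hw a]. *)
Lemma M_lambda_related M : M_lambda a M -> exists2 b, related M b & T_lambda a b.
Proof.
pose Q M := exists2 b, related M b & T_lambda a b.
have H x y : clos_refl_sym_trans _ (@arrow _ (monomial_crystal n)) x y -> Q x <-> Q y.
  elim=> {x y} [x y [i f]|x|x y _ [] ? ?|x y z _ [xy yx] _ [yz zy]] //.
    split=> [[b r tb]|[b r tb]]; have [_ _ _ he hf] := related_crystal i r.
      move: hf; rewrite f; case fb: (kash_f i b) => [b'|] //= r'.
      by exists b' => //; exact: T_lambda_f tb fb.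
    move: he; rewrite /= (mon_f_e f); case eb: (kash_e i b) => [b'|] //= r'.
    by exists b' => //; exact: T_lambda_e tb eb.
  by split=> [/xy/yz|/zy/yx].
move=> /H[+ _]; apply; have [b0 r0 _] := hw_related.
by exists b0 => //; exact: hw_T.
Qed.

(** Climbing by [kash_e] ends at the only highest weight tableau, which is related to [mon_hw a];
    the path is retraced with [kash_f] on both sides. *)
Lemma T_lambda_related b : T_lambda a b -> exists2 M, related M b & M_lambda a M.
Proof.
have [k] := ubnP (sumn (word_of b)); elim: k b => // k IH b bk tb.
have [[i ei]|no] := pselect (exists i, kash_e i b <> None); last first.
  have [b0 r0 w0] := hw_related; exists (mon_hw a); last exact: rst_refl.
  rewrite (_ : b = b0) //; apply: word_of_inj; rewrite w0; apply: T_lambda_hw => // i.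
  by apply: contrapT => ei; apply: no; exists i.
case eb: (kash_e i b) ei => [b'|] // _.
have [_ _ Ee _] := word_of_crystal i b; move: Ee; rewrite eb /= => /esym/we_step st.
have [|M r mM] := IH b' _ (T_lambda_e tb eb); first by rewrite (step_sumn st) in bk.
have [_ _ _ _] := related_crystal i r.
have [_ _ _] := word_of_crystal i b'; rewrite (step_wf st).
case: (kash_f i b') => //= b'' [/word_of_inj ->].
case f: (mon_f i M) => [M'|] //= r'; exists M' => //.
by apply: rst_trans mM _; apply: rst_step; exists i.
Qed.

Lemma related_iso : exists psi, crystal_iso (M_lambda a) (T_lambda a) psi.
Proof.
(* The default [[::]] makes [psi] total; every monomial of [M_lambda a] has good rows. *)
pose rows M := xget [::] [set r | good_rows r /\ monom n r = M].
pose psi M := pure_tensor (num_boxes a) (map (@inord n) (g (flatten (rows M)))).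
have psiE M b : related M b -> psi M = b.
  move=> r; have [r0 [[s l h] e wb]] := r.
  have er : rows M = r0.
    apply: xget_unique => // y [[sy ly hy] ey].
    by apply: (@monom_inj n) => //; rewrite ?hy ?h ?ey ?e.
  apply: word_of_inj; rewrite /psi er -wb word_of_pure ?size_map ?size_word_of //.
  rewrite -map_comp map_id_in // => x xw /=; rewrite inordK // ltnS.
  exact: (allP (word_of_le b)).
have orelE x y : orel x y -> y = omap psi x.
  by case: x y => [M|] [b|] //= /psiE ->.
exists psi; split; first split.
- by move=> M /M_lambda_related[b /psiE ->].
- move=> M M' /set_mem/M_lambda_related[b r _] /set_mem/M_lambda_related[b' r' _].
  rewrite (psiE _ _ r) (psiE _ _ r') => ebb; rewrite -ebb in r'; exact: related_inj r r'.
- by move=> b /T_lambda_related[M /psiE e mM]; exists M.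
- move=> i M /M_lambda_related[b r _]; have [? ? ? he hf] := related_crystal i r.
  by rewrite (psiE _ _ r); split=> //; exact: orelE.
Qed.

End Isomorphism.

Local Close Scope ring_scope.

Theorem corollary4p6 (n : nat) (n_ge1 : 1 <= n) (a : 'I_n -> nat) :
  exists psi : monomial_crystal n -> tensor_power n (num_boxes a),
    crystal_iso (M_lambda a) (T_lambda a) psi.
Proof.
have [rows [s rn e]] := hw_rows a.
have [g ga gw] := hw_conn s rn e.
have rn' : all (geq n) (flatten rows) by apply: sub_all rn => x /= /ltnW.
have sz : size (g (flatten rows)) = num_boxes a.
  rewrite gw /hw_word size_flatten /shape -map_comp map_id_in => [|k _ /=].
    exact: sumn_rev.
  by rewrite size_iota.
have [b0 wb0] : exists b : tensor_power n (num_boxes a), word_of b = g (flatten rows).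
  apply: word_of_surj => //; case: ga => _ gp _ _.
  by rewrite (perm_all _ (gp _)).
(* The base points correspond: [g] carries the row reading of the highest weight filling to the
   column reading of the highest weight tableau. *)
have r0 : related (shape rows) g (mon_hw a) b0 by exists rows.
apply: (@related_iso n a (shape rows) g ga); first by exists b0; rewrite ?wb0.
move=> b /(related_fun r0) <-; apply/T_lambdaP.
exists [seq iota 0 k | k <- rev (col_lengths a)]; split.
- exact/tableau_iota/sorted_col_lengths.
- by rewrite /shape -map_comp map_id_in // => k _ /=; rewrite size_iota.
- by rewrite wb0.
Qed.
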